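(* For $a\in(0,1]$ let $R_a=[-1,1]\times[-a,a]$, let $\sigma_1(R_a)$ be its first nontrivial Steklov eigenvalue, and let $4(1+a)$ be its perimeter. Among all $a\in(0,1]$, the value $a=1$ maximizes $4(1+a)\,\sigma_1(R_a)$. That is, among all rectangles of a given perimeter, the square maximizes the first nontrivial Steklov eigenvalue.
   Context: For a bounded planar Lipschitz domain $\Omega$, a Steklov eigenvalue is a real number $\sigma$ for which there is a nonzero function $s$ (a Steklov eigenfunction) with $\Delta s = 0$ in $\Omega$ and $\partial_n s = \sigma s$ on $\partial\Omega$, where $\partial_n$ is the outward normal derivative (for a rectangle: the conditions hold on the open sides, or equivalently in the weak $H^1$ sense). The eigenvalues form a discrete sequence $0=\sigma_0<\sigma_1\le\sigma_2\le\cdots$, and $\sigma_1(\Omega)$ denotes the smallest nonzero (nontrivial) eigenvalue. The product of $\sigma_1$ with the perimeter is invariant under scaling, and every rectangle is similar to some $R_a$ with $a\in(0,1]$. *)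

(* Defs.v *)
From Stdlib Require Import Reals.
From Coquelicot Require Import Coquelicot.
Open Scope R_scope.

Definition partial_x (f : R * R -> R) (P : R * R) : R :=
  Derive (fun t => f (t, snd P)) (fst P).

Definition partial_y (f : R * R -> R) (P : R * R) : R :=
  Derive (fun t => f (fst P, t)) (snd P).

Definition laplacian (f : R * R -> R) (P : R * R) : R :=
  partial_x (partial_x f) P + partial_y (partial_y f) P.

Definition C1_on (U : R * R -> Prop) (f : R * R -> R) : Prop :=
  forall P, U P ->
    ex_derive (fun t => f (t, snd P)) (fst P) /\
    ex_derive (fun t => f (fst P, t)) (snd P) /\
    continuous (partial_x f) P /\ continuous (partial_y f) P.

Definition C2_on (U : R * R -> Prop) (f : R * R -> R) : Prop :=
  C1_on U f /\ C1_on U (partial_x f) /\ C1_on U (partial_y f).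

(* Rectangles are [-p, p] x [-q, q], given by their half-sides p and q. *)
Definition open_rect (p q : R) (P : R * R) : Prop :=
  - p < fst P < p /\ - q < snd P < q.

Definition closed_rect (p q : R) (P : R * R) : Prop :=
  - p <= fst P <= p /\ - q <= snd P <= q.

(* [outward_normal p q P n]: P lies on an open side (corners excluded) and n is
   the outward unit normal there. *)
Inductive outward_normal (p q : R) : R * R -> R * R -> Prop :=
  | normal_right y : - q < y < q -> outward_normal p q (p, y) (1, 0)
  | normal_left y : - q < y < q -> outward_normal p q (- p, y) (- 1, 0)
  | normal_top x : - p < x < p -> outward_normal p q (x, q) (0, 1)
  | normal_bottom x : - p < x < p -> outward_normal p q (x, - q) (0, - 1).

(* The derivative is one-sided, taken from inside the domain. *)
Definition is_normal_derivative
    (f : R * R -> R) (P n : R * R) (l : R) : Prop :=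
  filterlim
    (fun h => (f P - f (fst P - h * fst n, snd P - h * snd n)) / h)
    (at_right 0) (locally l).

Definition extends_continuously_to
    (U : R * R -> Prop) (f : R * R -> R) (P : R * R) : Prop :=
  exists l : R, filterlim f (within U (locally P)) (locally l).

(* Classical solutions: C^2 inside, C^1 up to the open sides, and continuous on
   the closed rectangle.  Some control at the corners is indispensable: with
   conditions on the open sides only, solutions that blow up at a corner (and
   are not in H^1) would be admitted.  Weak H^1 eigenfunctions are exactly the
   ones described here, by elliptic regularity. *)
Record steklov_eigenfunction
    (p q sigma : R) (s : R * R -> R) : Prop := {
  eigenfunction_nonzero : exists P, closed_rect p q P /\ s P <> 0;
  eigenfunction_continuous : continuous_on (closed_rect p q) s;
  eigenfunction_C2 : C2_on (open_rect p q) s;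
  eigenfunction_C1_sides : forall P n, outward_normal p q P n ->
    extends_continuously_to (open_rect p q) (partial_x s) P /\
    extends_continuously_to (open_rect p q) (partial_y s) P;
  eigenfunction_harmonic : forall P, open_rect p q P -> laplacian s P = 0;
  eigenfunction_boundary : forall P n, outward_normal p q P n ->
    is_normal_derivative s P n (sigma * s P)
}.

Definition steklov_eigenvalue (p q sigma : R) : Prop :=
  exists s : R * R -> R, steklov_eigenfunction p q sigma s.

(* [is_sigma1 p q sigma]: sigma is the smallest nonzero Steklov eigenvalue of
   [-p, p] x [-q, q]. *)
Definition is_sigma1 (p q sigma : R) : Prop :=
  steklov_eigenvalue p q sigma /\ sigma <> 0 /\
  forall tau, steklov_eigenvalue p q tau -> tau <> 0 -> sigma <= tau.

Definition perimeter (p q : R) : R := 2 * (2 * p) + 2 * (2 * q).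

(* Main.v *)
Require Import Defs.
From Stdlib Require Import Reals Lra List Classical ClassicalEpsilon FunctionalExtensionality.
From Coquelicot Require Import Coquelicot.
Open Scope R_scope.

(* Let alpha in (0, 1) satisfy cos alpha cosh alpha = sin alpha sinh alpha.  A
   rectangle with half-sides q <= p has the eigenfunction sin(wx) cosh(wy) with
   w p >= alpha, whose eigenvalue is at most alpha tanh(alpha) / p since x cot x
   decreases.  It remains to see that a nonzero eigenvalue t of [-1, 1]^2 is at
   least alpha tanh(alpha).  Suppose t is smaller.  The maximum principle,
   applied to the ratio of the eigenfunction and a perturbation of
   sin(alpha x) cosh(alpha y), shows that the eigenfunction u is even in each
   variable.  Then u (x, y) - u (z, y) is harmonic in (x, y, z) and vanishes for
   z = x and z = -x; comparing it with a multiple of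
   (cos(alpha z) - cos(alpha x)) cosh(alpha y) bounds the increments of u along
   each side by c max u and c max (-u) with c < 1.  As u changes sign on the
   boundary, this makes its oscillation zero.  In each comparison the corners are
   removed by adding a small function that blows up logarithmically there. *)

(** * Compactness and touching points *)

(** Eigenfunctions are only known to be continuous at the corners, so pointwise comparison replaces
    integration by parts and Rayleigh quotients throughout. A touching point at a corner carries no
    information, as no normal exists there; hence the part that is infinite at the corners.
    Comparison with a positive strict supersolution succeeds for functions odd in one variable. It
    must fail for even ones: a positive superharmonic v with outward derivative at least t v > 0
    contradicts the divergence theorem. Increments get around this: they annihilate constants and
    vanish on z = x and z = -x. The price is the face x = 1, where their normal derivative is t u
    and is controlled only through the maximum of u, so that the outcome is a contraction and not an
    immediate vanishing. The equation for alpha says that sin(alpha x) cosh(alpha y) satisfies the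
    boundary condition on all four sides of [-1, 1]^2 with one value, alpha cot alpha = alpha tanh
    alpha. *)

Lemma functional_choice {A B : Type} (P : A -> B -> Prop) :
  (forall x, exists y, P x y) -> exists f, forall x, P x (f x).
Proof.
intros H.
exists (fun x => proj1_sig (constructive_indefinite_description _ (H x))).
intros x. exact (proj2_sig (constructive_indefinite_description _ (H x))).
Qed.

Lemma filterlim_lincomb {T : Type} {F : (T -> Prop) -> Prop} {FF : Filter F}
    (f g : T -> R) (a b lf lg : R) :
  filterlim f F (locally lf) -> filterlim g F (locally lg) ->
  filterlim (fun x => a * f x + b * g x) F (locally (a * lf + b * lg)).
Proof.
intros Hf Hg.
apply (filterlim_comp_2 (F := F) (G := locally (a * lf)) (H := locally (b * lg))
         (fun x => a * f x) (fun x => b * g x) Rplus).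
- apply filterlim_comp with (1 := Hf). apply (filterlim_scal_r a lf).
- apply filterlim_comp with (1 := Hg). apply (filterlim_scal_r b lg).
- apply (filterlim_plus (a * lf) (b * lg)).
Qed.

(** Compactness through gauges: the radius depends on the centre, and the centres lie in [K]. This
    form passes directly to products and yields maxima without extracting subsequences. *)
Definition compact_set {T : UniformSpace} (K : T -> Prop) : Prop :=
  forall d : T -> posreal, exists l : list T,
    (forall t, In t l -> K t) /\
    (forall x, K x -> exists t, In t l /\ ball t (d t) x).

Lemma compact_segment (a b : R) :
  @compact_set R_UniformSpace (fun x => a <= x <= b).
Proof.
intros d.
(* [compactness_list] speaks of tuples ending in [tt] and gives its list under a double negation;
   centres outside the segment are filtered out. *)
destruct (NNPP _ (compactness_list 1 (a, tt) (b, tt) (fun x => d (fst x))))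
  as [l Hl].
exists (filter (fun x => if excluded_middle_informative (a <= x <= b)
                         then true else false) (map fst l)).
split.
- intros t Ht. apply filter_In in Ht. destruct Ht as [_ Ht].
  now destruct (excluded_middle_informative _).
- intros x Hx. destruct (Hl (x, tt)) as [[t []] [Ht [[Hb _] [Hc _]]]].
  { now split. }
  exists t. split; [|exact Hc].
  apply filter_In. split.
  + apply in_map_iff. now exists (t, tt).
  + now destruct (excluded_middle_informative _).
Qed.

Lemma compact_singleton {T : UniformSpace} (a : T) :
  compact_set (fun x => x = a).
Proof.
intros d. exists (a :: nil). split.
- intros t [<-|[]]. reflexivity.
- intros x ->. exists a. split; [now left|apply ball_center].
Qed.

Lemma compact_union {T : UniformSpace} (K L : T -> Prop) :
  compact_set K -> compact_set L -> compact_set (fun x => K x \/ L x).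
Proof.
intros HK HL d.
destruct (HK d) as [k [Hk1 Hk2]], (HL d) as [l [Hl1 Hl2]].
exists (k ++ l). split.
- intros t Ht. apply in_app_or in Ht. destruct Ht; auto.
- intros x [Hx|Hx]; [destruct (Hk2 x Hx) as [t [H1 H2]]|
                     destruct (Hl2 x Hx) as [t [H1 H2]]];
  exists t; (split; [apply in_or_app; auto|auto]).
Qed.

Lemma list_lower_bound {T : Type} (d : T -> posreal) (l : list T) :
  exists e : posreal, forall t, In t l -> e <= d t.
Proof.
induction l as [|t l [e He]].
- exists (mkposreal 1 Rlt_0_1). intros t [].
- exists (mkposreal _ (Rmin_stable_in_posreal e (d t))).
  intros s [<-|Hs]; simpl.
  + apply Rmin_r.
  + eapply Rle_trans; [apply Rmin_l|auto].
Qed.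

(** The tube argument: over each [x] finitely many balls cover the slice, and a common lower bound
    of their radii serves as gauge on the first factor. *)
Lemma compact_prod {T U : UniformSpace} (K : T -> Prop) (L : U -> Prop) :
  compact_set K -> compact_set L ->
  @compact_set (prod_UniformSpace T U) (fun P => K (fst P) /\ L (snd P)).
Proof.
intros HK HL d.
assert (H : forall x, exists le : list U * posreal,
  (forall t, In t (fst le) -> L t) /\
  (forall y, L y -> exists t, In t (fst le) /\ ball t (d (x, t)) y) /\
  (forall t, In t (fst le) -> snd le <= d (x, t))).
{ intros x. destruct (HL (fun y => d (x, y))) as [l [H1 H2]].
  destruct (list_lower_bound (fun y => d (x, y)) l) as [e He].
  now exists (l, e). }
destruct (functional_choice _ H) as [f Hf].
destruct (HK (fun x => snd (f x))) as [k [Hk1 Hk2]].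
exists (flat_map (fun x => map (fun y => (x, y)) (fst (f x))) k). split.
- intros [x y] Hxy. apply in_flat_map in Hxy. destruct Hxy as [x' [Hx Hy]].
  apply in_map_iff in Hy. destruct Hy as [y' [E Hy]]. injection E as -> ->.
  split; simpl; [auto|now apply (Hf x)].
- intros [x y] [Hx Hy]. simpl in Hx, Hy.
  destruct (Hk2 x Hx) as [x0 [Hx0 Bx]].
  destruct (Hf x0) as [_ [H2 H3]].
  destruct (H2 y Hy) as [y0 [Hy0 By]].
  exists (x0, y0). split.
  + apply in_flat_map. exists x0. split; [auto|].
    apply in_map_iff. now exists y0.
  + split; simpl; [|exact By].
    now apply ball_le with (2 := Bx), H3.
Qed.

Lemma list_argmax {T : Type} (g : T -> R) (t0 : T) (l : list T) :
  exists t, In t (t0 :: l) /\ forall s, In s (t0 :: l) -> g s <= g t.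
Proof.
induction l as [|a l [t [H1 H2]]].
- exists t0. split; [now left|]. intros s [<-|[]]. lra.
- destruct (Rle_dec (g a) (g t)) as [H|H].
  + exists t. split.
    * destruct H1; [now left|now right; right].
    * intros s [<-|[<-|Hs]]; [apply H2; now left|auto|apply H2; now right].
  + exists a. split; [now right; left|].
    assert (g t < g a) by lra.
    intros s [<-|[<-|Hs]].
    * apply Rle_trans with (g t); [apply H2; now left|lra].
    * lra.
    * apply Rle_trans with (g t); [apply H2; now right|lra].
Qed.

(** Without a maximum, each [t] has some [s] of larger value, and semicontinuity keeps [g] below
    [g s] on a ball about [t]. Among the finitely many [s] of a cover, one of largest value lies in
    such a ball and so has a smaller value than another of them. *)
Lemma compact_usc_max {T : UniformSpace} (K : T -> Prop) (g : T -> R) :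
  compact_set K -> (exists t, K t) ->
  (forall t, K t -> forall c, g t < c -> within K (locally t) (fun x => g x < c)) ->
  exists t, K t /\ forall x, K x -> g x <= g t.
Proof.
intros HK [t0 Ht0] Hu.
apply NNPP. intros Hn.
assert (H : forall t, exists sd : T * posreal, K t ->
  K (fst sd) /\ forall x, ball t (snd sd) x -> K x -> g x < g (fst sd)).
{ intros t. destruct (classic (K t)) as [Kt|Kt].
  2:{ exists (t0, mkposreal 1 Rlt_0_1). now intros. }
  assert (exists s, K s /\ g t < g s) as [s [Ks Hs]].
  { apply NNPP. intros H. apply Hn. exists t. split; [auto|].
    intros x Kx. apply Rnot_lt_le. intros Hx. apply H. now exists x. }
  destruct (Hu t Kt _ Hs) as [d Hd].
  exists (s, d). intros _. now split. }
destruct (functional_choice _ H) as [f Hf].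
destruct (HK (fun t => snd (f t))) as [l [H1 H2]].
destruct l as [|a l].
{ now destruct (H2 t0 Ht0) as [t [[] _]]. }
destruct (list_argmax (fun t => g (fst (f t))) a l) as [t [Ht Hmax]].
destruct (Hf t (H1 t Ht)) as [Kt _].
destruct (H2 _ Kt) as [s [Hs Bs]].
destruct (Hf s (H1 s Hs)) as [_ Hlt].
specialize (Hlt _ Bs Kt). specialize (Hmax s Hs). simpl in *. lra.
Qed.

(* The point where [max 1 (u / v)] is maximal is a point where some multiple
   [k v], with k > 1, touches u from above, unless u <= v everywhere.  The
   first alternative handles the points where v blows up. *)
Lemma le_of_no_touching {T : UniformSpace} (K G : T -> Prop) (u v : T -> R) :
  compact_set K -> (forall x, G x -> K x) -> (forall x, G x -> 0 < v x) ->
  (forall t, K t ->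
     within G (locally t) (fun x => u x <= v x) \/
     (G t /\
      filterlim u (within G (locally t)) (locally (u t)) /\
      filterlim v (within G (locally t)) (locally (v t)) /\
      (forall k, 1 < k -> u t = k * v t ->
         (forall x, G x -> u x <= k * v x) -> False))) ->
  forall x, G x -> u x <= v x.
Proof.
intros HK GK Hv Ht.
(* The value 1 off [G] makes [g] upper semicontinuous on all of [K], so a maximum exists although
   [G] need not be compact. *)
set (g := fun x => if excluded_middle_informative (G x /\ v x < u x)
                   then u x / v x else 1).
assert (g1 : forall x, 1 <= g x).
{ intros x. unfold g. destruct (excluded_middle_informative _) as [[Gx H]|H]; [|lra].
  specialize (Hv x Gx). apply Rmult_le_reg_r with (v x); [auto|].
  unfold Rdiv. rewrite Rmult_assoc, Rinv_l; lra. }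
assert (gle : forall x, G x -> u x <= g x * v x).
{ intros x Gx. specialize (Hv x Gx). unfold g.
  destruct (excluded_middle_informative _) as [[_ H]|H].
  - apply Req_le. field. lra.
  - destruct (Rle_dec (u x) (v x)); [lra|]. exfalso. apply H. split; [auto|lra]. }
intros x0 Gx0.
destruct (compact_usc_max K g HK) as [t [Kt Hmax]].
- exists x0; auto.
- intros t Kt c Hc.
  assert (c1 : 1 < c) by (specialize (g1 t); lra).
  destruct (Ht t Kt) as [[d Hd]|[Gt [Cu [Cv _]]]].
  + exists d. intros x Bx Kx. unfold g.
    destruct (excluded_middle_informative _) as [[Gx H]|H]; [|lra].
    specialize (Hd x Bx Gx). lra.
  + assert (Hlt : 0 < c * v t - u t).
    { specialize (Hv t Gt). specialize (gle t Gt). nra. }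
    assert (C : filterlim (fun x => c * v x - u x) (within G (locally t))
                  (locally (c * v t - u t))).
    { replace (c * v t - u t) with (c * v t + (-1) * u t) by ring.
      apply filterlim_ext with (fun x => c * v x + (-1) * u x); [intros; ring|].
      now apply filterlim_lincomb. }
    assert (P : locally (c * v t - u t) (fun z => 0 < z)) by now apply open_gt.
    destruct (C _ P) as [d Hd].
    exists d. intros x Bx Kx. unfold g.
    destruct (excluded_middle_informative _) as [[Gx H]|H]; [|lra].
    specialize (Hd x Bx Gx). specialize (Hv x Gx).
    apply Rmult_lt_reg_r with (v x); [auto|].
    unfold Rdiv. rewrite Rmult_assoc, Rinv_l; lra.
- assert (Hg : forall x, G x -> u x <= g t * v x).
  { intros x Gx. specialize (gle x Gx). specialize (Hv x Gx).
    specialize (Hmax x (GK x Gx)). nra. }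
  destruct (Rle_lt_dec (g t) 1) as [H1|H1].
  { specialize (Hg x0 Gx0). specialize (Hv x0 Gx0). nra. }
  exfalso.
  destruct (Ht t Kt) as [[d Hd]|[Gt [_ [_ Hk]]]].
  + unfold g in H1. destruct (excluded_middle_informative _) as [[Gt H]|H]; [|lra].
    specialize (Hd t (ball_center t d) Gt). lra.
  + apply (Hk (g t) H1); [|exact Hg].
    unfold g in H1 |- *. destruct (excluded_middle_informative _) as [[_ H]|H]; [|lra].
    specialize (Hv t Gt). field. lra.
Qed.

(** * Second and normal derivatives *)

Section ContinuityRules.
Context {U : UniformSpace}.
Implicit Types (f g : U -> R) (x : U).

Lemma continuous_Rplus f g x :
  continuous f x -> continuous g x -> continuous (fun y => f y + g y) x.
Proof. apply (continuous_plus f g). Qed.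

Lemma continuous_Ropp f x : continuous f x -> continuous (fun y => - f y) x.
Proof. apply (continuous_opp f). Qed.

Lemma continuous_Rmult f g x :
  continuous f x -> continuous g x -> continuous (fun y => f y * g y) x.
Proof. apply (continuous_mult f g). Qed.

Lemma continuous_pow f x n :
  continuous f x -> continuous (fun y => f y ^ n) x.
Proof.
intros Hf. induction n as [|n IH]; simpl.
- apply continuous_const.
- now apply continuous_Rmult.
Qed.

Lemma continuous_sin_comp f x : continuous f x -> continuous (fun y => sin (f y)) x.
Proof.
intros Hf. apply continuous_comp; [exact Hf|].
apply (ex_derive_continuous sin). now auto_derive.
Qed.

Lemma continuous_cos_comp f x : continuous f x -> continuous (fun y => cos (f y)) x.
Proof.
intros Hf. apply continuous_comp; [exact Hf|].
apply (ex_derive_continuous cos). now auto_derive.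
Qed.

Lemma continuous_cosh_comp f x : continuous f x -> continuous (fun y => cosh (f y)) x.
Proof.
intros Hf. apply continuous_comp; [exact Hf|].
apply (ex_derive_continuous cosh). unfold cosh. now auto_derive.
Qed.

Lemma continuous_fst_comp {V W : UniformSpace} (f : U -> V * W) x :
  continuous f x -> continuous (fun y => fst (f y)) x.
Proof.
intros Hf. apply (continuous_comp f fst); [exact Hf|].
destruct (f x). apply continuous_fst.
Qed.

Lemma continuous_snd_comp {V W : UniformSpace} (f : U -> V * W) x :
  continuous f x -> continuous (fun y => snd (f y)) x.
Proof.
intros Hf. apply (continuous_comp f snd); [exact Hf|].
destruct (f x). apply continuous_snd.
Qed.

End ContinuityRules.

Ltac prove_continuous :=
  repeat (try assumption; lazymatch goal with
    | |- continuous (fun _ => ?c) _ => apply continuous_const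
    | |- continuous (fun x => x) _ => apply continuous_id
    | |- continuous (fun x => @?f x + @?g x) _ => apply (continuous_Rplus f g)
    | |- continuous (fun x => @?f x * @?g x) _ => apply (continuous_Rmult f g)
    | |- continuous (fun x => @?f x - @?g x) _ =>
        apply (continuous_Rplus f (fun x => - g x))
    | |- continuous (fun x => - @?f x) _ => apply (continuous_Ropp f)
    | |- continuous (fun x => @?f x ^ ?n) _ => apply (continuous_pow f)
    | |- continuous (fun x => sin (@?f x)) _ => apply (continuous_sin_comp f)
    | |- continuous (fun x => cos (@?f x)) _ => apply (continuous_cos_comp f)
    | |- continuous (fun x => cosh (@?f x)) _ => apply (continuous_cosh_comp f)
    | |- continuous (fun x => fst (@?f x)) _ => apply (continuous_fst_comp f)
    | |- continuous (fun x => snd (@?f x)) _ => apply (continuous_snd_comp f)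
    end).

Definition second_derivative (f : R -> R) (x l : R) : Prop :=
  exists f' : R -> R, locally x (fun t => is_derive f t (f' t)) /\ is_derive f' x l.

Lemma is_derive_lincomb (f g : R -> R) (a b x lf lg : R) :
  is_derive f x lf -> is_derive g x lg ->
  is_derive (fun t => a * f t + b * g t) x (a * lf + b * lg).
Proof.
intros Hf Hg. apply (is_derive_plus (fun t => a * f t) (fun t => b * g t)).
- now apply is_derive_scal.
- now apply is_derive_scal.
Qed.

Lemma second_derivative_lincomb (f g : R -> R) (a b x lf lg : R) :
  second_derivative f x lf -> second_derivative g x lg ->
  second_derivative (fun t => a * f t + b * g t) x (a * lf + b * lg).
Proof.
intros [f' [Hf Hf']] [g' [Hg Hg']].
exists (fun t => a * f' t + b * g' t). split.
- generalize (filter_and _ _ Hf Hg). apply filter_imp.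
  intros t [H1 H2]. now apply is_derive_lincomb.
- now apply is_derive_lincomb.
Qed.

Lemma second_derivative_const (c x : R) : second_derivative (fun _ => c) x 0.
Proof.
exists (fun _ => 0). split.
- apply filter_forall. intros t. apply (is_derive_const c).
- apply (is_derive_const 0).
Qed.

Lemma is_derive_comp_scal (f : R -> R) (m x l : R) :
  is_derive f (m * x) l -> is_derive (fun t => f (m * t)) x (m * l).
Proof.
intros H. apply (is_derive_comp f (fun t => m * t)); [exact H|].
auto_derive; [easy|ring].
Qed.

Lemma second_derivative_comp_scal (f : R -> R) (m x l : R) :
  second_derivative f (m * x) l ->
  second_derivative (fun t => f (m * t)) x (m * (m * l)).
Proof.
intros [f' [Hf Hf']]. exists (fun t => m * f' (m * t)). split.
- assert (C : continuous (fun t => m * t) x).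
  { apply (ex_derive_continuous (fun t : R => m * t)). now auto_derive. }
  specialize (C _ Hf). unfold filtermap in C. revert C.
  apply filter_imp. intros t Ht. now apply is_derive_comp_scal.
- apply is_derive_scal with (k := m). now apply is_derive_comp_scal.
Qed.

Lemma is_derive_local_max (f : R -> R) (x l : R) :
  is_derive f x l -> locally x (fun t => f t <= f x) -> l = 0.
Proof.
intros Hf [d Hd].
assert (D : derivable_pt f x) by (exists l; now apply is_derive_Reals).
assert (d0 := cond_pos d).
rewrite <- (is_derive_unique f x l Hf), <- (Derive_Reals f x D).
apply (deriv_maximum f (x - d) (x + d)); try lra.
intros t H1 H2. apply Hd. unfold ball; simpl; unfold AbsRing_ball, abs, minus, plus, opp; simpl.
apply Rabs_def1; lra.
Qed.

(** A positive second derivative at a critical point makes [f'] positive just to the right, and the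
    mean value theorem gives a larger value of [f] there. *)
Lemma second_derivative_local_max (f : R -> R) (x l : R) :
  second_derivative f x l -> locally x (fun t => f t <= f x) -> l <= 0.
Proof.
intros [f' [Hf Hf']] Hmax.
assert (f'x : f' x = 0).
{ apply is_derive_local_max with f x; [|exact Hmax].
  now apply (locally_singleton _ _ Hf). }
apply Rnot_lt_le. intros l0.
apply is_derive_Reals in Hf'.
destruct (Hf' (l / 2)) as [e He]; [lra|].
destruct Hf as [d1 Hd1], Hmax as [d2 Hd2].
assert (e0 := cond_pos e). assert (d10 := cond_pos d1). assert (d20 := cond_pos d2).
set (h := Rmin (e / 2) (Rmin (d1 / 2) (d2 / 2))).
assert (h0 : 0 < h) by (unfold h; repeat apply Rmin_glb_lt; lra).
assert (h1 : h <= e / 2) by apply Rmin_l.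
assert (h2 : h <= d1 / 2) by (eapply Rle_trans; [apply Rmin_r|apply Rmin_l]).
assert (h3 : h <= d2 / 2) by (eapply Rle_trans; [apply Rmin_r|apply Rmin_r]).
assert (B : forall t e, x - e < t < x + e -> ball x e t).
{ intros t e' Ht. unfold ball; simpl; unfold AbsRing_ball, abs, minus, plus, opp; simpl.
  apply Rabs_def1; lra. }
destruct (MVT_cor2 f f' x (x + h)) as [c [E Hc]]; [lra| |].
{ intros t Ht. apply is_derive_Reals, Hd1, B. lra. }
assert (f (x + h) <= f x) by (apply Hd2, B; lra).
specialize (He (c - x)). replace (x + (c - x)) with c in He by ring.
rewrite f'x in He.
assert (K : Rabs ((f' c - 0) / (c - x) - l) < l / 2).
{ apply He; [lra|]. rewrite Rabs_pos_eq; lra. }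
apply Rabs_def2 in K.
assert (0 < f' c).
{ replace (f' c) with ((f' c - 0) / (c - x) * (c - x)) by (field; lra).
  apply Rmult_lt_0_compat; lra. }
nra.
Qed.

Definition laplacian_value (f : R * R -> R) (P : R * R) (l : R) : Prop :=
  exists lx ly,
    second_derivative (fun t => f (t, snd P)) (fst P) lx /\
    second_derivative (fun t => f (fst P, t)) (snd P) ly /\
    lx + ly = l.

Lemma laplacian_value_lincomb (f g : R * R -> R) (a b : R) P lf lg :
  laplacian_value f P lf -> laplacian_value g P lg ->
  laplacian_value (fun Q => a * f Q + b * g Q) P (a * lf + b * lg).
Proof.
intros [fx [fy [Hfx [Hfy <-]]]] [gx [gy [Hgx [Hgy <-]]]].
exists (a * fx + b * gx), (a * fy + b * gy). split; [|split].
- now apply (second_derivative_lincomb (fun t => f (t, snd P))).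
- now apply (second_derivative_lincomb (fun t => f (fst P, t))).
- ring.
Qed.

Lemma laplacian_value_const (c : R) P : laplacian_value (fun _ => c) P 0.
Proof.
exists 0, 0. split; [|split]; [apply second_derivative_const..|ring].
Qed.

Lemma laplacian_value_local_max (f : R * R -> R) P l :
  laplacian_value f P l -> locally P (fun Q => f Q <= f P) -> l <= 0.
Proof.
intros [lx [ly [Hx [Hy <-]]]] [d Hd]. destruct P as [x y]; simpl in *.
apply second_derivative_local_max in Hx.
2:{ exists d. intros t Ht. apply Hd. split; [exact Ht|apply ball_center]. }
apply second_derivative_local_max in Hy.
2:{ exists d. intros t Ht. apply Hd. split; [apply ball_center|exact Ht]. }
lra.
Qed.

Lemma is_normal_derivative_lincomb (f g : R * R -> R) (a b : R) P n lf lg :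
  is_normal_derivative f P n lf -> is_normal_derivative g P n lg ->
  is_normal_derivative (fun Q => a * f Q + b * g Q) P n (a * lf + b * lg).
Proof.
intros Hf Hg. unfold is_normal_derivative.
eapply filterlim_ext; [|apply (filterlim_lincomb _ _ a b lf lg Hf Hg)].
intros h. unfold Rdiv. ring.
Qed.

Lemma is_normal_derivative_const (c : R) P n :
  is_normal_derivative (fun _ => c) P n 0.
Proof.
apply filterlim_ext with (fun _ => 0); [|apply filterlim_const].
intros h. unfold Rdiv. ring.
Qed.

Lemma is_normal_derivative_max (f : R * R -> R) P n l :
  is_normal_derivative f P n l ->
  at_right 0 (fun h => f (fst P - h * fst n, snd P - h * snd n) <= f P) ->
  0 <= l.
Proof.
intros Hl Hmax.
apply (filterlim_le (F := at_right 0) (fun _ => 0)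
  (fun h => (f P - f (fst P - h * fst n, snd P - h * snd n)) / h) 0 l).
- destruct Hmax as [d Hd]. exists d. intros h Bh h0. specialize (Hd h Bh h0).
  apply Rmult_le_reg_r with h; [exact h0|].
  unfold Rdiv. rewrite Rmult_assoc, Rinv_l; lra.
- apply filterlim_const.
- exact Hl.
Qed.

Lemma is_normal_derivative_is_derive (f : R * R -> R) P n l :
  is_derive (fun h => f (fst P - h * fst n, snd P - h * snd n)) 0 (- l) ->
  is_normal_derivative f P n l.
Proof.
intros H. apply is_derive_Reals in H.
apply filterlim_locally. intros e.
destruct (H e (cond_pos e)) as [d Hd].
exists d. intros h Bh h0.
unfold ball in Bh |- *; simpl in *; unfold AbsRing_ball, abs, minus, plus, opp in *; simpl in *.
rewrite Ropp_0, Rplus_0_r in Bh.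
assert (h1 : h <> 0) by lra.
specialize (Hd h h1 Bh).
rewrite <- Rabs_Ropp.
replace (f P) with (f (fst P - 0 * fst n, snd P - 0 * snd n)).
2:{ destruct P as [x y]; simpl. f_equal. f_equal; ring. }
rewrite Rplus_0_l in Hd.
eapply Rle_lt_trans; [|exact Hd]. apply Req_le. f_equal. field. exact h1.
Qed.

(** The normals are parallel to the axes: the zero component of [n] cancels the tangential
    derivative, so one formula covers the four sides. *)
Lemma is_normal_derivative_partials (f : R * R -> R) (p q : R) P n dx dy :
  is_derive (fun t => f (t, snd P)) (fst P) dx ->
  is_derive (fun t => f (fst P, t)) (snd P) dy ->
  outward_normal p q P n ->
  is_normal_derivative f P n (dx * fst n + dy * snd n).
Proof.
assert (A : forall (g : R -> R) m x d, is_derive g x d ->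
  is_derive (fun h => g (x - h * m)) 0 (- (d * m))).
{ intros g m x d H.
  assert (E : - m * d = - (d * m)) by ring. rewrite <- E.
  apply (is_derive_comp g (fun h => x - h * m)).
  - assert (E' : x - 0 * m = x) by ring. rewrite E'. exact H.
  - auto_derive; [easy|ring]. }
intros Hx Hy Hn. apply is_normal_derivative_is_derive.
destruct Hn as [y _|y _|x _|x _]; simpl in *.
1,2: eapply is_derive_ext; [intros t; apply (f_equal f), f_equal;
  symmetry; rewrite Rmult_0_r, Rminus_0_r; reflexivity|].
3,4: eapply is_derive_ext; [intros t; apply (f_equal f), (f_equal2 pair); [|reflexivity];
  symmetry; rewrite Rmult_0_r, Rminus_0_r; reflexivity|].
- replace (dx * 1 + dy * 0) with (dx * 1) by ring. now apply (A (fun t => f (t, y))).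
- replace (dx * -1 + dy * 0) with (dx * -1) by ring. now apply (A (fun t => f (t, y))).
- replace (dx * 0 + dy * 1) with (dy * 1) by ring. now apply (A (fun t => f (x, t))).
- replace (dx * 0 + dy * -1) with (dy * -1) by ring. now apply (A (fun t => f (x, t))).
Qed.

(** * A barrier at the corners *)

(* Vanishes exactly at the corners of [-1, 1]^2, with zero normal derivative on
   the sides. *)
Definition corner_gauge (x y : R) : R := (1 - x ^ 2) ^ 2 + (1 - y ^ 2) ^ 2.

(* The logarithm blows up at the corners; the factor makes its normal derivative
   on the sides dominate it, and the square root absorbs the singular part of
   the resulting Laplacian. *)
Definition barrier (c x y : R) : R :=
  (ln 2 - ln (corner_gauge x y)) * (1 - c * (2 - x ^ 2 - y ^ 2))
  - (2 + 10 * c) * sqrt (corner_gauge x y).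

Definition barrier_x (c x y : R) : R :=
  4 * x * (1 - x ^ 2) / corner_gauge x y * (1 - c * (2 - x ^ 2 - y ^ 2))
  + 2 * c * x * (ln 2 - ln (corner_gauge x y))
  + (2 + 10 * c) * (2 * x * (1 - x ^ 2) / sqrt (corner_gauge x y)).

Definition barrier_xx (c x y : R) : R :=
  ((4 * (1 - x ^ 2) - 8 * x ^ 2) / corner_gauge x y
     + 16 * x ^ 2 * (1 - x ^ 2) ^ 2 / corner_gauge x y ^ 2)
    * (1 - c * (2 - x ^ 2 - y ^ 2))
  + 16 * c * x ^ 2 * (1 - x ^ 2) / corner_gauge x y
  + 2 * c * (ln 2 - ln (corner_gauge x y))
  + (2 + 10 * c)
    * ((2 * (1 - x ^ 2) - 4 * x ^ 2) / sqrt (corner_gauge x y)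
       + 4 * x ^ 2 * (1 - x ^ 2) ^ 2 / sqrt (corner_gauge x y) ^ 3).

Lemma corner_gauge_sym (x y : R) : corner_gauge x y = corner_gauge y x.
Proof. unfold corner_gauge. ring. Qed.

Lemma barrier_sym (c x y : R) : barrier c x y = barrier c y x.
Proof.
unfold barrier. rewrite (corner_gauge_sym y x). f_equal. f_equal. ring.
Qed.

Lemma is_derive_barrier (c x y : R) :
  0 < corner_gauge x y -> is_derive (fun t => barrier c t y) x (barrier_x c x y).
Proof.
unfold barrier_x. remember (corner_gauge x y) as q eqn:Hq. intros q0.
assert (s0 := sqrt_lt_R0 _ q0).
unfold barrier, corner_gauge.
auto_derive; simpl;
  replace ((1 + - (x * (x * 1))) * ((1 + - (x * (x * 1))) * 1) +
           (1 - y * (y * 1)) * ((1 - y * (y * 1)) * 1)) with q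
    by (rewrite Hq; unfold corner_gauge; ring).
- intuition.
- field. lra.
Qed.

Lemma is_derive_barrier_x (c x y : R) :
  0 < corner_gauge x y -> is_derive (fun t => barrier_x c t y) x (barrier_xx c x y).
Proof.
unfold barrier_xx. remember (corner_gauge x y) as q eqn:Hq. intros q0.
assert (s0 := sqrt_lt_R0 _ q0).
assert (sq := sqrt_sqrt _ (Rlt_le _ _ q0)).
unfold barrier_x, corner_gauge.
auto_derive; simpl;
  replace ((1 + - (x * (x * 1))) * ((1 + - (x * (x * 1))) * 1) +
           (1 - y * (y * 1)) * ((1 - y * (y * 1)) * 1)) with q
    by (rewrite Hq; unfold corner_gauge; ring).
- assert (q <> 0) by lra. assert (sqrt q <> 0) by lra. intuition.
- set (l := ln q). set (s := sqrt q) in *. rewrite <- sq. field. lra.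
Qed.

Lemma second_derivative_barrier (c x y : R) :
  0 < corner_gauge x y -> second_derivative (fun t => barrier c t y) x (barrier_xx c x y).
Proof.
intros q0. exists (fun t => barrier_x c t y). split.
- assert (C : continuous (fun t => corner_gauge t y) x).
  { apply (ex_derive_continuous (fun t => corner_gauge t y)).
    unfold corner_gauge. now auto_derive. }
  assert (L := C _ (open_gt 0 _ q0)). unfold filtermap in L. revert L.
  apply filter_imp. intros t. apply is_derive_barrier.
- now apply is_derive_barrier_x.
Qed.

(** The root of the gauge measures the distance to a corner. The bound on [2 - x ^ 2 - y ^ 2] is the
    mean inequality; the one on the logarithm combines [- ln s <= / s - 1] with [ln 2 < 1]. *)
Lemma corner_gauge_bounds (x y : R) :
  -1 <= x <= 1 -> -1 <= y <= 1 -> 0 < corner_gauge x y ->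
  0 < sqrt (corner_gauge x y) <= 2 /\
  sqrt (corner_gauge x y) * sqrt (corner_gauge x y) = corner_gauge x y /\
  0 <= 2 - x ^ 2 - y ^ 2 <= 2 * sqrt (corner_gauge x y) /\
  0 <= ln 2 - ln (corner_gauge x y) <= 2 / sqrt (corner_gauge x y).
Proof.
intros Hx Hy q0.
assert (s0 := sqrt_lt_R0 _ q0). assert (sq := sqrt_sqrt _ (Rlt_le _ _ q0)).
set (s := sqrt _) in *.
assert (x2 := pow2_ge_0 x). assert (y2 := pow2_ge_0 y).
assert (a0 : 0 <= 1 - x ^ 2) by nra. assert (b0 : 0 <= 1 - y ^ 2) by nra.
assert (q2 : corner_gauge x y <= 2) by (unfold corner_gauge; nra).
split; [|split; [|split]].
- split; [exact s0|nra].
- exact sq.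
- split; [lra|]. apply Rsqr_incr_0_var; [|lra].
  unfold Rsqr. unfold corner_gauge in sq.
  replace (2 * s * (2 * s)) with (4 * (s * s)) by ring. rewrite sq.
  assert (I := pow2_ge_0 (x ^ 2 - y ^ 2)). nra.
- split.
  + apply Rle_minus_r. rewrite Rplus_0_l. now apply ln_le.
  + rewrite <- sq, ln_mult by assumption.
    assert (I : 1 + - ln s <= / s).
    { rewrite <- ln_Rinv by assumption. rewrite <- (exp_ln (/ s)) at 2.
      - apply exp_ineq1_le.
      - now apply Rinv_0_lt_compat. }
    assert (ln 2 < 1).
    { apply exp_lt_inv. rewrite exp_ln by lra. apply exp_ineq1. lra. }
    unfold Rdiv. lra.
Qed.

(** With [r = / sqrt (corner_gauge x y)], the logarithmic product contributes at most
    [(8 + 40 * c) * r + 16 * c] and the square root at most [(2 + 10 * c) * (12 - 4 * r)]. The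
    coefficient [2 + 10 * c] is chosen so that the terms in [r] cancel. *)
Lemma barrier_laplacian_le (c x y : R) :
  0 <= c -> -1 <= x <= 1 -> -1 <= y <= 1 -> 0 < corner_gauge x y ->
  barrier_xx c x y + barrier_xx c y x <= 24 + 136 * c.
Proof.
intros c0 Hx Hy q0.
destruct (corner_gauge_bounds x y Hx Hy q0) as [[s0 s2] [sq [[h0 hs] [l0 ls]]]].
assert (x2 := pow2_ge_0 x). assert (y2 := pow2_ge_0 y).
unfold barrier_xx. rewrite (corner_gauge_sym y x).
set (l := ln 2 - ln (corner_gauge x y)) in *.
set (h := 2 - x ^ 2 - y ^ 2) in *. replace (2 - y ^ 2 - x ^ 2) with h by (unfold h; ring).
assert (E : corner_gauge x y = (1 - x ^ 2) ^ 2 + (1 - y ^ 2) ^ 2) by reflexivity.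
set (s := sqrt _) in *. set (q := corner_gauge x y) in *.
set (r := / s). assert (r0 : 0 < r) by now apply Rinv_0_lt_compat.
assert (rs : r * s = 1) by (apply Rinv_l; lra).
(* [A] and [B] are the cosine and sine of a polar angle at the corner; they separate direction from
   the size [s]. *)
set (A := (1 - x ^ 2) * r). set (B := (1 - y ^ 2) * r).
assert (xA : x ^ 2 = 1 - A * s) by (unfold A; rewrite Rmult_assoc, rs; ring).
assert (yB : y ^ 2 = 1 - B * s) by (unfold B; rewrite Rmult_assoc, rs; ring).
assert (A0 : 0 <= A) by (apply Rmult_le_pos; nra).
assert (B0 : 0 <= B) by (apply Rmult_le_pos; nra).
assert (AB : A ^ 2 + B ^ 2 = 1).
{ unfold A, B. transitivity (q * (r * r)); [rewrite E; ring|].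
  rewrite <- sq. transitivity ((r * s) * (r * s)); [ring|]. rewrite rs. ring. }
assert (HAB : A + B <= 2).
{ assert (A <= 1) by nra. assert (B <= 1) by nra. lra. }
assert (PAB : 0 <= A * B <= 1 / 2) by (assert (I := pow2_ge_0 (A - B)); nra).
set (L := 12 * (A + B) - 16 * (A + B) * (1 - A * B)).
assert (L8 : - 8 <= L <= 8) by (unfold L; split; nra).
transitivity
  (r * L * (1 - c * ((A + B) * s)) + 16 * c * r * (x ^ 2 * A + y ^ 2 * B) + 4 * c * l
   + (2 + 10 * c) * (r * (- 4 + 6 * (A + B) * s - 4 * s * (A ^ 3 + B ^ 3)))).
- apply Req_le. rewrite <- sq.
  replace h with ((A + B) * s) by (unfold h; lra). rewrite xA, yB.
  (* The identity holds only modulo [A ^ 2 + B ^ 2 = 1]; an explicit multiple of [A ^ 2 + B ^ 2 - 1]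
     turns it into one that [field] verifies. *)
  match goal with |- ?a = ?b => transitivity (b + (A ^ 2 + B ^ 2 - 1) *
    ((16 * r ^ 2 - 16 * r * (A + B)) * (1 - c * ((A + B) * s)) + (2 + 10 * c) * 4 * r)) end.
  + unfold L, r. field. lra.
  + rewrite AB. ring.
- assert (T1 : r * L * (1 - c * ((A + B) * s)) <= 8 * r + 16 * c).
  { replace (r * L * (1 - c * ((A + B) * s))) with (r * L - c * (A + B) * L * (r * s)) by ring.
    rewrite rs. assert (r * L <= r * 8) by (apply Rmult_le_compat_l; lra).
    assert (- (c * ((A + B) * L)) <= c * 16).
    { rewrite Ropp_mult_distr_r. apply Rmult_le_compat_l; [exact c0|]. nra. }
    lra. }
  assert (T2 : 16 * c * r * (x ^ 2 * A + y ^ 2 * B) <= 32 * c * r).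
  { replace (32 * c * r) with (16 * c * r * 2) by ring.
    apply Rmult_le_compat_l; [nra|]. nra. }
  assert (T3 : 4 * c * l <= 8 * c * r).
  { unfold Rdiv in ls. fold r in ls. nra. }
  assert (T4 : r * (- 4 + 6 * (A + B) * s - 4 * s * (A ^ 3 + B ^ 3)) <= - 4 * r + 12).
  { replace (r * (- 4 + 6 * (A + B) * s - 4 * s * (A ^ 3 + B ^ 3)))
      with (- 4 * r + 6 * (A + B) * (r * s) - 4 * (r * s) * (A ^ 3 + B ^ 3)) by ring.
    rewrite rs. assert (0 <= A ^ 3) by now apply pow_le.
    assert (0 <= B ^ 3) by now apply pow_le. lra. }
  assert (T5 := Rmult_le_compat_l (2 + 10 * c) _ _ ltac:(lra) T4). lra.
Qed.

(** The logarithmic term is at most [2 / s] and [2 - x ^ 2 - y ^ 2] at most [2 * s], so the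
    correction by [c] costs only a constant. *)
Lemma barrier_ge (c x y : R) :
  0 <= c -> -1 <= x <= 1 -> -1 <= y <= 1 -> 0 < corner_gauge x y ->
  ln 2 - ln (corner_gauge x y) - 4 - 24 * c <= barrier c x y.
Proof.
intros c0 Hx Hy q0.
destruct (corner_gauge_bounds x y Hx Hy q0) as [[s0 s2] [sq [[h0 hs] [l0 ls]]]].
unfold barrier.
set (l := ln 2 - ln (corner_gauge x y)) in *. set (s := sqrt _) in *.
set (h := 2 - x ^ 2 - y ^ 2) in *.
assert (H : l * h <= 4).
{ apply Rle_trans with (2 / s * (2 * s)); [now apply Rmult_le_compat|].
  apply Req_le. field. lra. }
assert (c * (l * h) <= c * 4) by now apply Rmult_le_compat_l.
assert ((2 + 10 * c) * s <= (2 + 10 * c) * 2) by (apply Rmult_le_compat_l; lra).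
replace (l * (1 - c * h)) with (l - c * (l * h)) by ring. lra.
Qed.

Lemma barrier_ge_const (c x y : R) :
  0 <= c -> -1 <= x <= 1 -> -1 <= y <= 1 -> 0 < corner_gauge x y ->
  - (4 + 24 * c) <= barrier c x y.
Proof.
intros c0 Hx Hy q0. assert (H := barrier_ge c x y c0 Hx Hy q0).
destruct (corner_gauge_bounds x y Hx Hy q0) as [_ [_ [_ [l0 _]]]]. lra.
Qed.

Lemma barrier_large (c M : R) :
  0 <= c -> exists e : posreal, forall x y,
    -1 <= x <= 1 -> -1 <= y <= 1 -> 0 < corner_gauge x y < e -> M < barrier c x y.
Proof.
intros c0. exists (mkposreal _ (exp_pos (ln 2 - 4 - 24 * c - M))). simpl.
intros x y Hx Hy [q0 q1].
assert (H := barrier_ge c x y c0 Hx Hy q0).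
apply ln_increasing in q1; [|exact q0]. rewrite ln_exp in q1. lra.
Qed.

(** At [x = 1] and [x = -1], [x * barrier_x c x y] is the outward derivative. The gauge does not
    contribute to it, and what is left is [2 * c] times the logarithmic term, which dominates [T]
    times the barrier when [0 <= T <= c]. For negative [T] the lower bound of the barrier is
    used. *)
Lemma barrier_x_side (c T x y : R) :
  0 <= c -> T <= c -> x ^ 2 = 1 -> -1 <= y <= 1 -> 0 < corner_gauge x y ->
  T * barrier c x y <= x * barrier_x c x y + Rabs T * (4 + 24 * c) /\
  0 <= x * barrier_x c x y.
Proof.
intros c0 Tc x1 Hy q0.
assert (Hx : -1 <= x <= 1) by nra.
destruct (corner_gauge_bounds x y Hx Hy q0) as [[s0 s2] [sq [[h0 hs] [l0 ls]]]].
assert (Hb := barrier_ge_const c x y c0 Hx Hy q0).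
assert (E : x * barrier_x c x y = 2 * c * (ln 2 - ln (corner_gauge x y))).
{ unfold barrier_x. rewrite x1.
  transitivity (2 * c * x ^ 2 * (ln 2 - ln (corner_gauge x y))).
  - field. lra.
  - rewrite x1. ring. }
rewrite E. split; [|nra].
assert (Hu : barrier c x y <= ln 2 - ln (corner_gauge x y)).
{ unfold barrier. set (l := ln 2 - ln (corner_gauge x y)) in *. set (s := sqrt _) in *.
  assert (0 <= c * (l * (2 - x ^ 2 - y ^ 2)))
    by (repeat apply Rmult_le_pos; assumption).
  assert (0 <= (2 + 10 * c) * s) by (apply Rmult_le_pos; lra). nra. }
destruct (Rle_dec 0 T) as [T0|T0].
- rewrite Rabs_pos_eq by exact T0.
  apply Rle_trans with (T * (ln 2 - ln (corner_gauge x y))).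
  + now apply Rmult_le_compat_l.
  + assert (T * (ln 2 - ln (corner_gauge x y)) <= c * (ln 2 - ln (corner_gauge x y)))
      by (now apply Rmult_le_compat_r).
    assert (0 <= c * (ln 2 - ln (corner_gauge x y))) by now apply Rmult_le_pos.
    assert (0 <= T * (4 + 24 * c)) by nra. lra.
- rewrite Rabs_left by lra.
  assert (0 <= c * (ln 2 - ln (corner_gauge x y))) by now apply Rmult_le_pos.
  nra.
Qed.

Lemma continuous_corner_gauge (P : R * R) :
  continuous (fun Q : R * R => corner_gauge (fst Q) (snd Q)) P.
Proof. unfold corner_gauge. prove_continuous. Qed.

Lemma continuous_barrier (c : R) (P : R * R) :
  0 < corner_gauge (fst P) (snd P) ->
  continuous (fun Q : R * R => barrier c (fst Q) (snd Q)) P.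
Proof.
intros q0. assert (C := continuous_corner_gauge P). unfold barrier.
prove_continuous.
- apply continuous_comp; [exact C|]. apply (ex_derive_continuous ln).
  auto_derive. exact q0.
- apply continuous_comp; [exact C|]. apply (ex_derive_continuous sqrt).
  auto_derive. exact q0.
Qed.

(** * Comparison on the square *)

Lemma corner_gauge_gt0 (x y : R) :
  -1 < x < 1 \/ -1 < y < 1 -> 0 < corner_gauge x y.
Proof.
intros H. unfold corner_gauge.
assert (A := pow2_ge_0 (1 - x ^ 2)). assert (B := pow2_ge_0 (1 - y ^ 2)).
destruct H as [H|H].
- assert (0 < (1 - x ^ 2) ^ 2) by (apply pow_lt; nra). lra.
- assert (0 < (1 - y ^ 2) ^ 2) by (apply pow_lt; nra). lra.
Qed.

Lemma corner_gauge_inside (x y : R) :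
  -1 <= x <= 1 -> -1 <= y <= 1 -> 0 < corner_gauge x y ->
  -1 < x < 1 \/ -1 < y < 1.
Proof.
intros Hx Hy q0.
assert (A : forall z, -1 <= z <= 1 -> -1 < z < 1 \/ z ^ 2 = 1).
{ intros z Hz. destruct (Rle_lt_dec 1 z).
  - right. replace z with 1 by lra. ring.
  - destruct (Rle_lt_dec z (-1)); [|left; lra].
    right. replace z with (-1) by lra. ring. }
destruct (A x Hx) as [Ix|Ex]; [now left|].
destruct (A y Hy) as [Iy|Ey]; [now right|].
unfold corner_gauge in q0. rewrite Ex, Ey in q0. lra.
Qed.

Lemma outward_normal_gauge P n :
  outward_normal 1 1 P n ->
  -1 <= fst P <= 1 /\ -1 <= snd P <= 1 /\ 0 < corner_gauge (fst P) (snd P).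
Proof.
intros []; simpl; (split; [lra|split; [lra|apply corner_gauge_gt0; lra]]).
Qed.

Lemma laplacian_value_barrier (c : R) P :
  0 < corner_gauge (fst P) (snd P) ->
  laplacian_value (fun Q => barrier c (fst Q) (snd Q)) P
    (barrier_xx c (fst P) (snd P) + barrier_xx c (snd P) (fst P)).
Proof.
intros q0. exists (barrier_xx c (fst P) (snd P)), (barrier_xx c (snd P) (fst P)).
split; [|split]; [| |reflexivity]; simpl.
- now apply second_derivative_barrier.
- destruct (second_derivative_barrier c (snd P) (fst P)) as [g [H1 H2]].
  { now rewrite corner_gauge_sym. }
  exists g. split; [|exact H2]. revert H1. apply filter_imp. intros t.
  apply is_derive_ext. intros. apply barrier_sym.
Qed.

Lemma is_normal_derivative_barrier (c T : R) P n :
  0 <= c -> T <= c -> outward_normal 1 1 P n ->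
  exists l, is_normal_derivative (fun Q => barrier c (fst Q) (snd Q)) P n l /\
    T * barrier c (fst P) (snd P) <= l + Rabs T * (4 + 24 * c) /\ 0 <= l.
Proof.
intros c0 Tc Hn. destruct (outward_normal_gauge P n Hn) as [Hx [Hy q0]].
exists (barrier_x c (fst P) (snd P) * fst n + barrier_x c (snd P) (fst P) * snd n).
split.
- apply is_normal_derivative_partials with 1 1; [| |exact Hn]; simpl.
  + now apply is_derive_barrier.
  + apply is_derive_ext with (fun t => barrier c t (fst P)).
    * intros. apply barrier_sym.
    * apply is_derive_barrier. now rewrite corner_gauge_sym.
- assert (q0' := q0). rewrite corner_gauge_sym in q0'.
  destruct Hn as [y _|y _|x _|x _]; simpl in *.
  + destruct (barrier_x_side c T 1 y) as [A B]; try assumption; try ring; split; lra.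
  + destruct (barrier_x_side c T (- (1)) y) as [A B]; try assumption; try ring; split; lra.
  + rewrite (barrier_sym c x 1). destruct (barrier_x_side c T 1 x) as [A B]; try assumption; try ring; split; lra.
  + rewrite (barrier_sym c x (- (1))). destruct (barrier_x_side c T (- (1)) x) as [A B]; try assumption; try ring; split; lra.
Qed.

Lemma continuous_on_lt {T : UniformSpace} (D : T -> Prop) (f : T -> R) t c :
  continuous_on D f -> D t -> f t < c -> within D (locally t) (fun x => f x < c).
Proof. intros Hf Dt H. exact (Hf t Dt _ (open_lt c _ H)). Qed.

Lemma barrier_dominates (K : R * R -> Prop) (f : R * R -> R) (c e : R) t :
  0 <= c -> 0 < e ->
  (forall P, K P -> closed_rect 1 1 P) ->
  continuous_on K f -> K t -> corner_gauge (fst t) (snd t) <= 0 ->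
  locally t (fun P => K P -> 0 < corner_gauge (fst P) (snd P) ->
                      f P <= e * barrier c (fst P) (snd P)).
Proof.
intros c0 e0 HK Hf Kt Ht.
destruct (barrier_large c ((f t + 1) / e) c0) as [r Hr].
assert (A := continuous_on_lt K f t (f t + 1) Hf Kt ltac:(lra)).
assert (B : locally t (fun P => corner_gauge (fst P) (snd P) < r)).
{ apply (continuous_corner_gauge t (fun z => z < r)). apply (open_lt r).
  assert (r0 := cond_pos r). simpl in *. lra. }
generalize (filter_and (F := locally t) _ _ A B). apply filter_imp.
intros P [H1 H2] KP q0. destruct (HK P KP) as [Hx Hy].
specialize (H1 KP). specialize (Hr _ _ Hx Hy (conj q0 H2)).
apply Rlt_le, Rlt_le_trans with (1 := H1).
replace (f t + 1) with (e * ((f t + 1) / e)) by (field; lra).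
apply Rmult_le_compat_l; [lra|now apply Rlt_le].
Qed.

(** [v0] is a strict supersolution with margin [d] in the interior, on the sides and in size. Where
    a multiple of [v0] plus a little barrier touches [f] from above, the difference has a maximum,
    against the Laplacian or the normal derivative. The alternative on [x0] covers the full square,
    or a part of it with [f <= 0] on its left edge. *)
Lemma comparison (x0 T d : R) (f v0 : R * R -> R) :
  let K := fun P => x0 <= fst P <= 1 /\ -1 <= snd P <= 1 in
  -1 <= x0 < 1 -> 0 < d ->
  continuous_on K f ->
  (forall P, x0 < fst P < 1 -> -1 < snd P < 1 -> laplacian_value f P 0) ->
  (x0 = -1 \/ forall P, K P -> fst P = x0 -> f P <= 0) ->
  (forall P n, outward_normal 1 1 P n -> K P -> 0 < f P ->
     exists l, is_normal_derivative f P n l /\ l <= T * f P) ->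
  (forall P, K P -> continuous v0 P /\ d <= v0 P) ->
  (forall P, x0 < fst P < 1 -> -1 < snd P < 1 ->
     exists l, laplacian_value v0 P l /\ l <= - d) ->
  (forall P n, outward_normal 1 1 P n -> K P ->
     exists l, is_normal_derivative v0 P n l /\ T * v0 P + d <= l) ->
  forall P, K P -> f P <= 0.
Proof.
intros K Hx0 d0 Hf Hlap Hleft Hside Hv0 Hvlap Hvside.
set (c := Rabs T). assert (c0 : 0 <= c) by apply Rabs_pos.
assert (Tc : T <= c) by apply Rle_abs.
(* [N] bundles the three losses caused by the barrier, in the Laplacian, on the sides and in size;
   [e * N = d / 2] leaves half of each margin. *)
set (N := 24 + 136 * c + c * (4 + 24 * c) + (4 + 24 * c)).
assert (N0 : 0 < N) by (unfold N; nra).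
set (e := d / (2 * N)).
assert (e0 : 0 < e) by (apply Rdiv_lt_0_compat; lra).
assert (eN : e * N = d / 2) by (unfold e; field; lra).
assert (e1 : e * (24 + 136 * c) <= d / 2)
  by (rewrite <- eN; apply Rmult_le_compat_l; unfold N; nra).
assert (e2 : e * (c * (4 + 24 * c)) <= d / 2)
  by (rewrite <- eN; apply Rmult_le_compat_l; unfold N; nra).
assert (e3 : e * (4 + 24 * c) <= d / 2)
  by (rewrite <- eN; apply Rmult_le_compat_l; unfold N; nra).
set (w := fun P : R * R => barrier c (fst P) (snd P)).
set (G := fun P => K P /\ 0 < corner_gauge (fst P) (snd P)).
assert (Ksq : forall P, K P -> closed_rect 1 1 P).
{ intros P [H1 H2]. split; lra. }
assert (V0 : forall P, G P -> d / 2 <= v0 P + e * w P).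
{ intros P [KP q0]. destruct (Hv0 P KP) as [_ H]. destruct (Ksq P KP) as [Hx Hy].
  assert (B := barrier_ge_const c _ _ c0 Hx Hy q0).
  assert (e * - (4 + 24 * c) <= e * w P) by (apply Rmult_le_compat_l; [lra|exact B]).
  lra. }
(* The conditions on [f] are homogeneous, so the touching argument works for every multiple [k > 0];
   a small [k] then forces [f <= 0]. *)
assert (Hk : forall k, 0 < k -> forall P, G P -> f P <= k * v0 P + k * e * w P).
{ intros k k0.
  apply (le_of_no_touching K G).
  - apply (compact_prod (fun x => x0 <= x <= 1) (fun y => -1 <= y <= 1));
    apply compact_segment.
  - now intros P [KP _].
  - intros P GP. specialize (V0 P GP). nra.
  - intros P KP. destruct (Rle_lt_dec (corner_gauge (fst P) (snd P)) 0) as [q0|q0].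
    + left.
      assert (H := barrier_dominates K f c (k * e) P c0 ltac:(nra) Ksq Hf KP q0).
      revert H. unfold within. apply filter_imp. intros Q H [KQ qQ].
      specialize (H KQ qQ). destruct (Hv0 Q KQ) as [_ HQ].
      assert (0 <= k * v0 Q)
        by (apply Rmult_le_pos; [lra|apply Rle_trans with d; [lra|exact HQ]]).
      change (f Q <= k * e * w Q) in H. lra.
    + right.
      assert (GP : G P) by (now split).
      assert (CV : continuous (fun Q => k * v0 Q + k * e * w Q) P).
      { assert (C1 := proj1 (Hv0 P KP)). assert (C2 := continuous_barrier c P q0).
        unfold w. prove_continuous. }
      split; [exact GP|]. split; [|split].
      * intros S HS. specialize (Hf P KP S HS). revert Hf.
        unfold filtermap, within. apply filter_imp. intros Q H [KQ _]. now apply H.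
      * apply (filterlim_filter_le_1 _ (filter_le_within _) CV).
      * intros m m1 Em Hm.
        assert (mk : 0 < m * k) by nra.
        assert (fP : 0 < f P).
        { rewrite Em. replace (m * (k * v0 P + k * e * w P))
            with (m * k * (v0 P + e * w P)) by ring.
          apply Rmult_lt_0_compat; [exact mk|]. specialize (V0 P GP). lra. }
        set (phi := fun Q => 1 * f Q + (- m) * (k * v0 Q + k * e * w Q)).
        assert (phiP : phi P = 0) by (unfold phi; lra).
        assert (phiG : forall Q, G Q -> phi Q <= phi P).
        { intros Q GQ. specialize (Hm Q GQ). rewrite phiP. unfold phi. lra. }
        (* Touching on an open side is excluded once the inward normal stays in [G]; the cases below
           only check this. *)
        assert (Hn : forall n, outward_normal 1 1 P n ->
          at_right 0 (fun h => G (fst P - h * fst n, snd P - h * snd n)) -> False).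
        { intros n On Hin.
          destruct (Hside P n On KP fP) as [lf [Hlf lfle]].
          destruct (Hvside P n On KP) as [lv [Hlv lvge]].
          destruct (is_normal_derivative_barrier c T P n c0 Tc On) as [lw [Hlw [lwge _]]].
          assert (Hphi := is_normal_derivative_lincomb _ _ 1 (- m) P n _ _ Hlf
            (is_normal_derivative_lincomb _ _ k (k * e) P n _ _ Hlv Hlw)).
          assert (L : 0 <= 1 * lf + - m * (k * lv + k * e * lw)).
          { apply is_normal_derivative_max with phi P n; [exact Hphi|].
            revert Hin. apply filter_imp. intros h Gh. now apply phiG. }
          fold c in lwge. fold (w P) in lwge.
          assert (I : T * (v0 P + e * w P) < lv + e * lw).
          { assert (e * (T * w P) <= e * (lw + c * (4 + 24 * c)))
              by (apply Rmult_le_compat_l; lra). lra. }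
          assert (J : lf < m * k * (lv + e * lw)).
          { apply Rle_lt_trans with (1 := lfle). rewrite Em.
            replace (T * (m * (k * v0 P + k * e * w P)))
              with (m * k * (T * (v0 P + e * w P))) by ring.
            now apply Rmult_lt_compat_l. }
          lra. }
        destruct P as [x y]. destruct KP as [Kx Ky]. simpl in *.
        destruct (Rle_lt_dec x x0) as [Lx|Lx].
        { assert (x = x0) by lra. subst x.
          destruct Hleft as [E|Hl].
          - subst x0. destruct (corner_gauge_inside (-1) y) as [?|Iy]; try lra.
            apply (Hn (-1, 0)); [now apply normal_left|].
            exists (mkposreal 1 Rlt_0_1). intros h Bh h0. apply Rabs_def2 in Bh.
            unfold minus, plus, opp in Bh; simpl in Bh.
            split; [split; simpl; lra|simpl; apply corner_gauge_gt0; lra].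
          - specialize (Hl (x0, y) (conj Kx Ky) eq_refl). lra. }
        destruct (Rle_lt_dec 1 x) as [Ux|Ux].
        { assert (x = 1) by lra. subst x.
          destruct (corner_gauge_inside 1 y) as [?|Iy]; try lra.
          apply (Hn (1, 0)); [now apply normal_right|].
          assert (r0 : 0 < 1 - x0) by lra.
          exists (mkposreal _ r0). intros h Bh h0. apply Rabs_def2 in Bh.
          unfold minus, plus, opp in Bh; simpl in Bh.
          split; [split; simpl; lra|simpl; apply corner_gauge_gt0; lra]. }
        destruct (Rle_lt_dec 1 y) as [Uy|Uy].
        { assert (y = 1) by lra. subst y.
          apply (Hn (0, 1)); [apply normal_top; lra|].
          exists (mkposreal 1 Rlt_0_1). intros h Bh h0. apply Rabs_def2 in Bh.
          unfold minus, plus, opp in Bh; simpl in Bh.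
          split; [split; simpl; lra|simpl; apply corner_gauge_gt0; lra]. }
        destruct (Rle_lt_dec y (-1)) as [Ly|Ly].
        { assert (y = -1) by lra. subst y.
          apply (Hn (0, -1)); [apply normal_bottom; lra|].
          exists (mkposreal 1 Rlt_0_1). intros h Bh h0. apply Rabs_def2 in Bh.
          unfold minus, plus, opp in Bh; simpl in Bh.
          split; [split; simpl; lra|simpl; apply corner_gauge_gt0; lra]. }
        destruct (Hvlap (x, y)) as [lv [Hlv lvle]]; [simpl; lra|simpl; lra|].
        assert (Hphi := laplacian_value_lincomb _ _ 1 (- m) (x, y) _ _
          (Hlap (x, y) ltac:(simpl; lra) ltac:(simpl; lra))
          (laplacian_value_lincomb _ _ k (k * e) (x, y) _ _ Hlv
             (laplacian_value_barrier c (x, y) q0))).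
        apply laplacian_value_local_max in Hphi.
        -- assert (B := barrier_laplacian_le c x y c0 ltac:(lra) Ky q0). simpl in Hphi.
           set (lw := barrier_xx c x y + barrier_xx c y x) in *.
           assert (e * lw <= e * (24 + 136 * c)) by (apply Rmult_le_compat_l; lra).
           assert (I : lv + e * lw < 0) by lra.
           assert (m * k * (lv + e * lw) < 0) by nra. lra.
        -- assert (r0 : 0 < Rmin (Rmin (x - x0) (1 - x)) (Rmin (y + 1) (1 - y)))
             by (repeat apply Rmin_glb_lt; lra).
           exists (mkposreal _ r0). intros [x' y'] [Bx By].
           apply phiG. simpl in Bx, By.
           apply Rabs_def2 in Bx. apply Rabs_def2 in By.
           unfold minus, plus, opp in Bx, By; simpl in Bx, By.
           assert (M1 := Rmin_l (Rmin (x - x0) (1 - x)) (Rmin (y + 1) (1 - y))).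
           assert (M2 := Rmin_r (Rmin (x - x0) (1 - x)) (Rmin (y + 1) (1 - y))).
           assert (M3 := Rmin_l (x - x0) (1 - x)). assert (M4 := Rmin_r (x - x0) (1 - x)).
           assert (M5 := Rmin_l (y + 1) (1 - y)). assert (M6 := Rmin_r (y + 1) (1 - y)).
           split; [split; simpl; lra|simpl; apply corner_gauge_gt0; lra]. }
assert (HG : forall P, G P -> f P <= 0).
{ intros P GP. apply Rnot_lt_le. intros fP. specialize (V0 P GP).
  assert (H := Hk (f P / (2 * (v0 P + e * w P))) ltac:(apply Rdiv_lt_0_compat; lra) P GP).
  replace (f P / (2 * (v0 P + e * w P)) * v0 P + f P / (2 * (v0 P + e * w P)) * e * w P)
    with (f P / 2) in H by (field; lra). lra. }
(* The corners left out of [G] are limits of its points under horizontal shifts. *)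
intros P KP. apply Rnot_lt_le. intros fP.
assert (H := Hf P KP _ (open_gt 0 _ fP)).
destruct H as [r Hr]. destruct P as [x y]. destruct KP as [Kx Ky]; simpl in Kx, Ky.
assert (r0 := cond_pos r).
set (h := Rmin (r / 2) ((1 - x0) / 2)).
assert (h0 : 0 < h) by (apply Rmin_glb_lt; lra).
assert (h1 : h <= r / 2) by apply Rmin_l.
assert (h2 : h <= (1 - x0) / 2) by apply Rmin_r.
assert (exists x', x0 < x' < 1 /\ Rabs (x' - x) < r) as [x' [Ix Bx]].
{ destruct (Rle_lt_dec x ((1 + x0) / 2)).
  - exists (x + h / 2). split; [lra|]. apply Rabs_def1; lra.
  - exists (x - h / 2). split; [lra|]. apply Rabs_def1; lra. }
assert (Gq : G (x', y)).
{ split; [split; simpl; lra|]. simpl. apply corner_gauge_gt0. lra. }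
assert (B : ball (x, y) r (x', y)) by (split; [exact Bx|apply ball_center]).
specialize (Hr _ B (proj1 Gq)). simpl in Hr. specialize (HG _ Gq). lra.
Qed.

(** * Increments of an eigenfunction *)

(* [steklov_eigenfunction 1 1 t u] without the nonvanishing condition, so as to be
   preserved by linear combinations. *)
Record steklov_core (t : R) (u : R * R -> R) : Prop := {
  core_continuous : continuous_on (closed_rect 1 1) u;
  core_harmonic : forall P, open_rect 1 1 P -> laplacian_value u P 0;
  core_boundary : forall P n, outward_normal 1 1 P n ->
    is_normal_derivative u P n (t * u P)
}.

Lemma filterlim_within_subset {T : UniformSpace} (D E : T -> Prop) (f : T -> R) t :
  continuous_on D f -> D t -> (forall x, E x -> D x) ->
  filterlim f (within E (locally t)) (locally (f t)).
Proof.
intros Hf Dt ED S HS. specialize (Hf t Dt S HS). revert Hf.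
unfold filtermap, within. apply filter_imp. intros x H Ex. apply H, ED, Ex.
Qed.

Lemma continuous_on_comp {T U : UniformSpace} (D : T -> Prop) (E : U -> Prop)
    (g : T -> U) (f : U -> R) :
  continuous_on E f -> (forall t, continuous g t) -> (forall t, D t -> E (g t)) ->
  continuous_on D (fun t => f (g t)).
Proof.
intros Hf Hg DE t Dt S HS.
specialize (Hf (g t) (DE t Dt) S HS). specialize (Hg t _ Hf). revert Hg.
unfold filtermap, within. apply filter_imp. intros x H Dx. apply H, DE, Dx.
Qed.

Lemma continuous_on_lincomb {T : UniformSpace} (D : T -> Prop) (f g : T -> R) a b :
  continuous_on D f -> continuous_on D g ->
  continuous_on D (fun x => a * f x + b * g x).
Proof.
intros Hf Hg x Dx. apply filterlim_lincomb; [exact (Hf x Dx)|exact (Hg x Dx)].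
Qed.

Lemma continuous_on_le_closure {T : UniformSpace} (D : T -> Prop) (f : T -> R) t c :
  continuous_on D f -> D t ->
  (forall S, locally t S -> exists x, S x /\ D x /\ f x <= c) -> f t <= c.
Proof.
intros Hf Dt H. apply Rnot_lt_le. intros Hlt.
destruct (H _ (Hf t Dt _ (open_gt c _ Hlt))) as [x [H1 [Dx H2]]].
specialize (H1 Dx). simpl in H1. lra.
Qed.

(** [wedge] is not a product, so compactness is taken from this surrounding box. Near points outside
    [wedge] the touching criterion is vacuous, because the complement is open. *)
Definition box3 (P : (R * R) * R) : Prop :=
  (0 <= fst (fst P) <= 1 /\ -1 <= snd (fst P) <= 1) /\ -1 <= snd P <= 1.

Definition wedge (P : (R * R) * R) : Prop :=
  closed_rect 1 1 (fst P) /\ - fst (fst P) <= snd P <= fst (fst P).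

Lemma compact_box3 : compact_set box3.
Proof.
apply (compact_prod (fun Q : R * R => 0 <= fst Q <= 1 /\ -1 <= snd Q <= 1)
         (fun z => -1 <= z <= 1)).
- apply (compact_prod (fun x => 0 <= x <= 1) (fun y => -1 <= y <= 1));
  apply compact_segment.
- apply compact_segment.
Qed.

Lemma wedge_open_complement P :
  ~ wedge P -> box3 P -> locally P (fun Q => ~ wedge Q).
Proof.
intros NW [[Hx Hy] Hz].
assert (H : fst (fst P) - snd P < 0 \/ fst (fst P) + snd P < 0).
{ apply NNPP. intros N. apply NW. split; [split; lra|lra]. }
destruct H as [H|H].
- assert (C : continuous (fun Q : (R * R) * R => fst (fst Q) - snd Q) P) by prove_continuous.
  specialize (C _ (open_lt 0 _ H)). unfold filtermap in C. revert C.
  apply filter_imp. intros Q HQ [_ W]. lra.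
- assert (C : continuous (fun Q : (R * R) * R => fst (fst Q) + snd Q) P) by prove_continuous.
  specialize (C _ (open_lt 0 _ H)). unfold filtermap in C. revert C.
  apply filter_imp. intros Q HQ [_ W]. lra.
Qed.

(** The contradiction at a touching point on the faces [y = 1] and [y = -1]: [v] and [w] are the
    values of the comparison function and of the barrier, [lv] and [lw] their normal derivatives,
    [l] that of the increment. *)
Lemma robin_margin (t d e m c v w lv lw l : R) :
  0 < t -> 0 < d -> 0 < e -> 1 < m -> e * (c * (4 + 24 * c)) <= d / 2 ->
  t * w <= lw + c * (4 + 24 * c) -> t * v + d <= lv ->
  m * (lv + e * lw) <= l -> l = t * (m * (1 * v + e * w)) -> False.
Proof.
intros t0 d0 e0 m1 He Hw Hv Hl ->.
assert (H := Rmult_le_compat_l e _ _ (Rlt_le _ _ e0) Hw).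
assert (I : t * (1 * v + e * w) < lv + e * lw) by lra.
apply (Rmult_lt_compat_l m) in I; lra.
Qed.

(* The increment [u (x, y) - u (z, y)] is harmonic in the three variables
   [x, y, z]; this replaces a bound on the partial derivative of u, which is
   not known to be regular up to the boundary. *)
Lemma increment_comparison (t M d : R) (u : R * R -> R) (v0 : (R * R) * R -> R) :
  steklov_core t u -> 0 < t -> 0 < d ->
  (forall P, closed_rect 1 1 P -> u (- fst P, snd P) = u P) ->
  (forall y, -1 < y < 1 -> u (1, y) <= M) ->
  (forall P, wedge P -> continuous v0 P /\ d <= v0 P) ->
  (forall P, wedge P -> exists lx ly lz,
     second_derivative (fun s => v0 ((s, snd (fst P)), snd P)) (fst (fst P)) lx /\
     second_derivative (fun s => v0 ((fst (fst P), s), snd P)) (snd (fst P)) ly /\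
     second_derivative (fun s => v0 (fst P, s)) (snd P) lz /\ lx + ly + lz <= - d) ->
  (forall y z, -1 < y < 1 -> -1 <= z <= 1 ->
     exists l, is_normal_derivative (fun Q => v0 (Q, z)) (1, y) (1, 0) l /\
               0 <= l /\ t * M + d <= l) ->
  (forall P n z, outward_normal 1 1 P n -> -1 < fst P < 1 -> wedge (P, z) ->
     exists l, is_normal_derivative (fun Q => v0 (Q, z)) P n l /\
               t * v0 (P, z) + d <= l) ->
  forall P, wedge P -> u (fst P) - u (snd P, snd (fst P)) <= v0 P.
Proof.
intros [Hc Hh Hb] t0 d0 Heven HM Hv0 Hvlap Hvx Hvy.
set (c := t). assert (c0 : 0 <= c) by (unfold c; lra).
set (N := 24 + 136 * c + c * (4 + 24 * c) + (4 + 24 * c)).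
assert (N0 : 0 < N) by (unfold N; nra).
set (w := fun P : (R * R) * R => barrier c (fst (fst P)) (snd (fst P))).
set (D := fun P : (R * R) * R => 1 * u (fst P) + (-1) * u (snd P, snd (fst P))).
set (G := fun P => wedge P /\ 0 < corner_gauge (fst (fst P)) (snd (fst P))).
assert (WK : forall P, wedge P -> box3 P).
{ intros P [[Hx Hy] Hz]. split; [split|]; lra. }
assert (CD : continuous_on wedge D).
{ apply continuous_on_lincomb.
  - apply continuous_on_comp with (closed_rect 1 1); [exact Hc| |].
    + intros Q. apply continuous_fst_comp, continuous_id.
    + now intros P [HP _].
  - apply (continuous_on_comp _ (closed_rect 1 1) (fun P => (snd P, snd (fst P))));
      [exact Hc| |].
    + intros [[x y] z]. intros S [r Hr]. exists r.
      intros [[x' y'] z'] [[Bx By] Bz]. apply Hr. now split.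
    + intros P [[Hx Hy] Hz]. split; simpl; lra. }
assert (He : forall e, 0 < e -> e * N <= d / 2 ->
             forall P, G P -> D P <= 1 * v0 P + e * w P).
{ intros e e0 eN.
  assert (e1 : e * (24 + 136 * c) <= d / 2).
  { apply Rle_trans with (2 := eN). apply Rmult_le_compat_l; unfold N; nra. }
  assert (e2 : e * (c * (4 + 24 * c)) <= d / 2).
  { apply Rle_trans with (2 := eN). apply Rmult_le_compat_l; unfold N; nra. }
  assert (e3 : e * (4 + 24 * c) <= d / 2).
  { apply Rle_trans with (2 := eN). apply Rmult_le_compat_l; unfold N; nra. }
  assert (V0 : forall P, G P -> d / 2 <= 1 * v0 P + e * w P).
  { intros P [WP q0]. destruct (Hv0 P WP) as [_ H]. destruct WP as [[Hx Hy] Hz].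
    assert (B := barrier_ge_const c _ _ c0 Hx Hy q0).
    assert (e * - (4 + 24 * c) <= e * w P) by (apply Rmult_le_compat_l; [lra|exact B]).
    lra. }
  apply (le_of_no_touching box3 G).
  - apply compact_box3.
  - intros P [WP _]. now apply WK.
  - intros P GP. specialize (V0 P GP). lra.
  - intros P KP. destruct (classic (wedge P)) as [WP|NW].
    2:{ left. generalize (wedge_open_complement P NW KP). unfold within.
        apply filter_imp. intros Q NQ [WQ _]. contradiction. }
    destruct (Rle_lt_dec (corner_gauge (fst (fst P)) (snd (fst P))) 0) as [q0|q0].
    + left.
      assert (Hc1 : continuous_on (closed_rect 1 1) (fun _ => D P + 1)).
      { apply continuous_on_forall. intros. apply continuous_const. }
      assert (A := barrier_dominates (closed_rect 1 1) (fun _ => D P + 1) c e (fst P)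
                     c0 e0 (fun _ H => H) Hc1 (proj1 WP) q0).
      assert (C : continuous (fun Q : (R * R) * R => fst Q) P) by prove_continuous.
      specialize (C _ A). unfold filtermap in C.
      assert (B := continuous_on_lt wedge D P (D P + 1) CD WP ltac:(lra)).
      generalize (filter_and (F := locally P) _ _ C B). unfold within.
      apply filter_imp. intros Q [H1 H2] [WQ qQ].
      specialize (H1 (proj1 WQ) qQ). specialize (H2 WQ).
      destruct (Hv0 Q WQ) as [_ HQ].
      change (D P + 1 <= e * w Q) in H1. lra.
    + right. assert (GP : G P) by (now split).
      assert (CV : continuous (fun Q => 1 * v0 Q + e * w Q) P).
      { assert (C1 := proj1 (Hv0 P WP)).
        assert (C2 : continuous w P).
        { apply (continuous_comp (fun Q : (R * R) * R => fst Q)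
                   (fun Q => barrier c (fst Q) (snd Q))).
          - prove_continuous.
          - now apply continuous_barrier. }
        prove_continuous. }
      split; [exact GP|]. split; [|split].
      * apply filterlim_within_subset with wedge; [exact CD|exact WP|]. now intros Q [WQ _].
      * apply (filterlim_filter_le_1 _ (filter_le_within _) CV).
      * intros m m1 Em Hm.
        assert (DP : 0 < D P).
        { rewrite Em. apply Rmult_lt_0_compat; [lra|]. specialize (V0 P GP). lra. }
        set (phi := fun Q => 1 * D Q + (- m) * (1 * v0 Q + e * w Q)).
        assert (phiP : phi P = 0) by (unfold phi; lra).
        assert (phiG : forall Q, G Q -> phi Q <= phi P).
        { intros Q GQ. specialize (Hm Q GQ). rewrite phiP. unfold phi. lra. }
        destruct P as [[x y] z]. destruct WP as [[Wx Wy] Wz]. simpl in Wx, Wy, Wz.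
        simpl in q0.
        (* The increment vanishes for [z = x], and by evenness for [z = - x]. A touching point
           therefore has [(z, y)] away from the corners. *)
        destruct (Req_dec z x) as [->|Nx].
        { unfold D in DP. simpl in DP. lra. }
        destruct (Req_dec z (- x)) as [->|Nx'].
        { unfold D in DP. simpl in DP.
          assert (E := Heven (x, y) ltac:(split; simpl; lra)). simpl in E.
          rewrite E in DP. lra. }
        assert (Iz : - x < z < x) by lra.
        assert (Hn : forall n lf lv, outward_normal 1 1 (x, y) n ->
          is_normal_derivative (fun Q => D (Q, z)) (x, y) n lf ->
          is_normal_derivative (fun Q => v0 (Q, z)) (x, y) n lv ->
          at_right 0 (fun h => G ((x - h * fst n, y - h * snd n), z)) ->
          exists lw, 0 <= lw /\ t * w ((x, y), z) <= lw + c * (4 + 24 * c) /\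
                     m * (lv + e * lw) <= lf).
        { intros n lf lv On Hlf Hlv Hin.
          destruct (is_normal_derivative_barrier c t (x, y) n c0 ltac:(unfold c; lra) On)
            as [lw [Hlw [lw1 lw2]]].
          exists lw. split; [exact lw2|split].
          - rewrite Rabs_pos_eq in lw1 by lra. exact lw1.
          - assert (Hphi := is_normal_derivative_lincomb _ _ 1 (- m) (x, y) n _ _ Hlf
              (is_normal_derivative_lincomb _ _ 1 e (x, y) n _ _ Hlv Hlw)).
            assert (L : 0 <= 1 * lf + - m * (1 * lv + e * lw)).
            { apply is_normal_derivative_max with (fun Q => phi (Q, z)) (x, y) n;
                [exact Hphi|].
              revert Hin. apply filter_imp. intros h Gh. now apply phiG. }
            lra. }
        (* On the face [x = 1] the term [u (z, y)] is constant along the normal, so the increment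
           has flux [t * u (1, y) <= t * M]. *)
        destruct (Rle_lt_dec 1 x) as [Ux|Ux].
        { assert (x = 1) by lra. subst x.
          destruct (corner_gauge_inside 1 y) as [?|Iy]; try lra.
          destruct (Hvx y z Iy) as [lv [Hlv [lv0 lv1]]]; [lra|].
          destruct (Hn (1, 0) (1 * (t * u (1, y)) + (-1) * 0) lv) as [lw [lw0 [lw1 lw2]]].
          - now apply normal_right.
          - apply (is_normal_derivative_lincomb u (fun Q => u (z, snd Q))).
            + apply (Hb (1, y)). now apply normal_right.
            + apply filterlim_ext with (fun _ => 0); [|apply filterlim_const].
              intros h. simpl. rewrite Rmult_0_r, Rminus_0_r. unfold Rdiv. ring.
          - exact Hlv.
          - assert (r0 : 0 < (1 - Rabs z) / 2).
            { assert (Rabs z < 1) by (apply Rabs_def1; lra). lra. }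
            exists (mkposreal _ r0). intros h Bh h0. apply Rabs_def2 in Bh.
            unfold minus, plus, opp in Bh; simpl in Bh.
            assert (Z1 := Rle_abs z). assert (Z2 := Rle_abs (- z)).
            rewrite Rabs_Ropp in Z2.
            split; [split; [split|]; simpl; lra|simpl; apply corner_gauge_gt0; lra].
          - assert (t * u (1, y) <= t * M) by (apply Rmult_le_compat_l; [lra|auto]).
            assert (0 <= e * lw) by (apply Rmult_le_pos; lra).
            assert (1 * (lv + e * lw) <= m * (lv + e * lw))
              by (apply Rmult_le_compat_r; lra).
            lra. }
        (* For [y = 1] or [y = -1] both [(x, y)] and [(z, y)] lie on the same side, so the increment
           itself satisfies the Robin condition. *)
        assert (Hy : forall n, outward_normal 1 1 (x, y) n ->
          outward_normal 1 1 (z, y) n -> fst n = 0 ->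
          at_right 0 (fun h => G ((x - h * fst n, y - h * snd n), z)) -> False).
        { intros n On On' n0 Hin.
          assert (W : wedge ((x, y), z)) by (repeat split; simpl; lra).
          destruct (Hvy (x, y) n z On ltac:(simpl; lra) W) as [lv [Hlv lv1]].
          destruct (Hn n (1 * (t * u (x, y)) + (-1) * (t * u (z, y))) lv)
            as [lw [lw0 [lw1 lw2]]]; [exact On| |exact Hlv|exact Hin|].
          - apply (is_normal_derivative_lincomb u (fun Q => u (z, snd Q))).
            + now apply (Hb (x, y)).
            + apply filterlim_ext with (2 := Hb (z, y) n On').
              intros h. simpl. now rewrite n0, Rmult_0_r, Rminus_0_r.
          - assert (Ht : 1 * (t * u (x, y)) + (-1) * (t * u (z, y))
                         = t * (m * (1 * v0 ((x, y), z) + e * w ((x, y), z)))).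
            { transitivity (t * D ((x, y), z)); [unfold D; simpl; ring|].
              f_equal. exact Em. }
            exact (robin_margin t d e m c _ _ lv lw _ t0 d0 e0 m1 e2 lw1 lv1 lw2 Ht). }
        destruct (Rle_lt_dec 1 y) as [Uy|Uy].
        { assert (y = 1) by lra. subst y.
          apply (Hy (0, 1)); [apply normal_top; lra|apply normal_top; lra|reflexivity|].
          exists (mkposreal 1 Rlt_0_1). intros h Bh h0. apply Rabs_def2 in Bh.
          unfold minus, plus, opp in Bh; simpl in Bh.
          split; [split; [split|]; simpl; lra|simpl; apply corner_gauge_gt0; lra]. }
        destruct (Rle_lt_dec y (-1)) as [Ly|Ly].
        { assert (y = -1) by lra. subst y.
          apply (Hy (0, -1));
            [apply normal_bottom; lra|apply normal_bottom; lra|reflexivity|].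
          exists (mkposreal 1 Rlt_0_1). intros h Bh h0. apply Rabs_def2 in Bh.
          unfold minus, plus, opp in Bh; simpl in Bh.
          split; [split; [split|]; simpl; lra|simpl; apply corner_gauge_gt0; lra]. }
        assert (W : wedge ((x, y), z)) by (repeat split; simpl; lra).
        destruct (Hvlap _ W) as [vx [vy [vz [Hvx1 [Hvy1 [Hvz1 Hv]]]]]].
        destruct (Hh (x, y)) as [ux [uy [Hux [Huy Hu]]]]; [split; simpl; lra|].
        destruct (Hh (z, y)) as [tx [ty [Htx [Hty Htt]]]]; [split; simpl; lra|].
        destruct (laplacian_value_barrier c (x, y) q0) as [wx [wy [Hwx [Hwy Hw]]]].
        simpl in Hvx1, Hvy1, Hvz1, Hux, Huy, Htx, Hty, Hwx, Hwy, Hw.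
        assert (Loc : locally ((x, y), z) G).
        { set (g := Rmin (Rmin (1 - x) (Rmin (y + 1) (1 - y)))
                         (Rmin ((x - z) / 2) ((x + z) / 2))).
          assert (r0 : 0 < g) by (repeat apply Rmin_glb_lt; lra).
          exists (mkposreal _ r0). intros [[x' y'] z'] [[Bx By] Bz].
          simpl in Bx, By, Bz.
          apply Rabs_def2 in Bx. apply Rabs_def2 in By. apply Rabs_def2 in Bz.
          unfold minus, plus, opp in Bx, By, Bz; simpl in Bx, By, Bz.
          assert (M1 := Rmin_l (Rmin (1 - x) (Rmin (y + 1) (1 - y)))
                         (Rmin ((x - z) / 2) ((x + z) / 2))).
          assert (M2 := Rmin_r (Rmin (1 - x) (Rmin (y + 1) (1 - y)))
                         (Rmin ((x - z) / 2) ((x + z) / 2))).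
          fold g in M1, M2.
          assert (M3 := Rmin_l (1 - x) (Rmin (y + 1) (1 - y))).
          assert (M4 := Rmin_r (1 - x) (Rmin (y + 1) (1 - y))).
          assert (M5 := Rmin_l (y + 1) (1 - y)). assert (M6 := Rmin_r (y + 1) (1 - y)).
          assert (M7 := Rmin_l ((x - z) / 2) ((x + z) / 2)).
          assert (M8 := Rmin_r ((x - z) / 2) ((x + z) / 2)).
          split; [split; [split|]; simpl; lra|simpl; apply corner_gauge_gt0; lra]. }
        destruct Loc as [r Hr].
        (* The three variables are tested separately. In the sum the Laplacians of [u] at [(x, y)]
           and at [(z, y)] drop out, [tx] being supplied by the variable [z]. *)
        assert (Lx : 1 * (1 * ux + (-1) * 0) + (- m) * (1 * vx + e * wx) <= 0).
        { apply second_derivative_local_max with (fun s => phi ((s, y), z)) x.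
          - apply (second_derivative_lincomb (fun s => D ((s, y), z))
              (fun s => 1 * v0 ((s, y), z) + e * w ((s, y), z)) 1 (- m)).
            + apply (second_derivative_lincomb (fun s => u (s, y)) (fun s => u (z, y)) 1 (-1));
                [exact Hux|apply second_derivative_const].
            + apply (second_derivative_lincomb (fun s => v0 ((s, y), z))
                (fun s => barrier c s y) 1 e); [exact Hvx1|exact Hwx].
          - exists r. intros s Bs. apply phiG, Hr.
            split; [split; [exact Bs|apply ball_center]|apply ball_center]. }
        assert (Ly' : 1 * (1 * uy + (-1) * ty) + (- m) * (1 * vy + e * wy) <= 0).
        { apply second_derivative_local_max with (fun s => phi ((x, s), z)) y.
          - apply (second_derivative_lincomb (fun s => D ((x, s), z))
              (fun s => 1 * v0 ((x, s), z) + e * w ((x, s), z)) 1 (- m)).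
            + apply (second_derivative_lincomb (fun s => u (x, s)) (fun s => u (z, s)) 1 (-1));
                [exact Huy|exact Hty].
            + apply (second_derivative_lincomb (fun s => v0 ((x, s), z))
                (fun s => barrier c x s) 1 e); [exact Hvy1|exact Hwy].
          - exists r. intros s Bs. apply phiG, Hr.
            split; [split; [apply ball_center|exact Bs]|apply ball_center]. }
        assert (Lz : 1 * (1 * 0 + (-1) * tx) + (- m) * (1 * vz + e * 0) <= 0).
        { apply second_derivative_local_max with (fun s => phi ((x, y), s)) z.
          - apply (second_derivative_lincomb (fun s => D ((x, y), s))
              (fun s => 1 * v0 ((x, y), s) + e * w ((x, y), s)) 1 (- m)).
            + apply (second_derivative_lincomb (fun s => u (x, y)) (fun s => u (s, y)) 1 (-1));
                [apply second_derivative_const|exact Htx].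
            + apply (second_derivative_lincomb (fun s => v0 ((x, y), s))
                (fun s => barrier c x y) 1 e); [exact Hvz1|apply second_derivative_const].
          - exists r. intros s Bs. apply phiG, Hr.
            split; [apply ball_center|exact Bs]. }
        assert (B := barrier_laplacian_le c x y c0 ltac:(lra) ltac:(lra) q0).
        rewrite <- Hw in B.
        assert (e * (wx + wy) <= e * (24 + 136 * c)) by (apply Rmult_le_compat_l; lra).
        assert (I : (vx + vy + vz) + e * (wx + wy) < 0) by lra.
        assert (m * ((vx + vy + vz) + e * (wx + wy)) < 0) by nra.
        lra. }
assert (HG : forall P, G P -> D P <= v0 P).
{ intros P GP. apply Rnot_lt_le. intros Hlt.
  (* The second entry keeps [e * w P] at most half of the assumed excess; this is the limit of small
     [e] at the fixed point [P]. *)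
  set (e := Rmin (d / (2 * N)) ((D P - v0 P) / (2 * (Rabs (w P) + 1)))).
  assert (W0 := Rabs_pos (w P)). assert (W1 := Rle_abs (w P)).
  assert (e0 : 0 < e) by (apply Rmin_glb_lt; apply Rdiv_lt_0_compat; lra).
  assert (e1 : e * N <= d / 2).
  { apply Rle_trans with (d / (2 * N) * N).
    - apply Rmult_le_compat_r; [lra|apply Rmin_l].
    - apply Req_le. field. lra. }
  assert (e2 : e * (Rabs (w P) + 1) <= (D P - v0 P) / 2).
  { apply Rle_trans with ((D P - v0 P) / (2 * (Rabs (w P) + 1)) * (Rabs (w P) + 1)).
    - apply Rmult_le_compat_r; [lra|apply Rmin_r].
    - apply Req_le. field. lra. }
  specialize (He e e0 e1 P GP).
  assert (e * w P <= e * (Rabs (w P) + 1)) by (apply Rmult_le_compat_l; lra).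
  lra. }
assert (HW : forall P, wedge P -> D P <= v0 P).
{ intros P WP.
  assert (CF : continuous_on wedge (fun Q => 1 * D Q + (-1) * v0 Q)).
  { apply continuous_on_lincomb; [exact CD|].
    apply continuous_on_forall. intros Q WQ. apply (Hv0 Q WQ). }
  assert (H : 1 * D P + (-1) * v0 P <= 0); [|lra].
  apply (continuous_on_le_closure wedge (fun Q => 1 * D Q + (-1) * v0 Q) P 0 CF WP).
  intros S [r Hr].
  destruct P as [[x y] z]. destruct WP as [[Wx Wy] Wz]. simpl in Wx, Wy, Wz.
  assert (r0 := cond_pos r).
  (* Only [y] is moved, since moving [x] could leave the wedge. *)
  assert (exists y', -1 < y' < 1 /\ Rabs (y' - y) < r) as [y' [Iy By]].
  { set (h := Rmin (r / 2) 1).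
    assert (h0 : 0 < h) by (apply Rmin_glb_lt; lra).
    assert (h1 : h <= r / 2) by apply Rmin_l.
    assert (h2 : h <= 1) by apply Rmin_r.
    destruct (Rle_lt_dec y 0).
    - exists (y + h / 2). split; [lra|]. apply Rabs_def1; lra.
    - exists (y - h / 2). split; [lra|]. apply Rabs_def1; lra. }
  exists ((x, y'), z).
  assert (W : wedge ((x, y'), z)) by (repeat split; simpl; lra).
  split; [|split].
  - apply Hr. split; [split; [apply ball_center|exact By]|apply ball_center].
  - exact W.
  - assert (GQ : G ((x, y'), z)).
    { split; [exact W|]. simpl. apply corner_gauge_gt0. lra. }
    specialize (HG _ GQ). simpl in HG |- *. lra. }
intros P WP. specialize (HW P WP). unfold D in HW. lra.
Qed.

(** * Lower bound on the square *)

Lemma steklov_core_lincomb (t a b : R) (u v : R * R -> R) :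
  steklov_core t u -> steklov_core t v ->
  steklov_core t (fun P => a * u P + b * v P).
Proof.
intros [Cu Hu Bu] [Cv Hv Bv]. split.
- now apply continuous_on_lincomb.
- intros P HP. replace 0 with (a * 0 + b * 0) by ring.
  apply laplacian_value_lincomb; auto.
- intros P n Hn. replace (t * (a * u P + b * v P)) with (a * (t * u P) + b * (t * v P)) by ring.
  apply is_normal_derivative_lincomb; auto.
Qed.

(** The summand [0 * u P] gives the opposite function the literal shape of a linear combination. *)
Lemma steklov_core_opp (t : R) (u : R * R -> R) :
  steklov_core t u -> steklov_core t (fun P => (-1) * u P + 0 * u P).
Proof. intros H. now apply steklov_core_lincomb. Qed.

Lemma steklov_core_swap (t : R) (u : R * R -> R) :
  steklov_core t u -> steklov_core t (fun P => u (snd P, fst P)).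
Proof.
intros [Cu Hu Bu]. split.
- apply (continuous_on_comp _ (closed_rect 1 1) (fun P => (snd P, fst P))); [exact Cu| |].
  + intros [x y] S [r Hr]. exists r. intros [x' y'] [Bx By]. apply Hr. now split.
  + intros P [Hx Hy]. now split.
- intros [x y] [Hx Hy].
  destruct (Hu (y, x)) as [lx [ly [H1 [H2 H3]]]]; [now split|].
  exists ly, lx. split; [exact H2|split; [exact H1|lra]].
- intros P n Hn. destruct Hn.
  + apply (Bu (y, 1) (0, 1)). now apply normal_top.
  + apply (Bu (y, - (1)) (0, -1)). now apply normal_bottom.
  + apply (Bu (1, x) (1, 0)). now apply normal_right.
  + apply (Bu (- (1), x) (-1, 0)). now apply normal_left.
Qed.

Lemma steklov_core_reflect (t : R) (u : R * R -> R) :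
  steklov_core t u -> steklov_core t (fun P => u (-1 * fst P, snd P)).
Proof.
intros [Cu Hu Bu]. split.
- apply (continuous_on_comp _ (closed_rect 1 1) (fun P => (-1 * fst P, snd P)));
    [exact Cu| |].
  + intros [x y] S [r Hr]. exists r. intros [x' y'] [Bx By]. apply Hr. split; [|exact By].
    apply Rabs_def2 in Bx. unfold minus, plus, opp in Bx; simpl in Bx.
    apply Rabs_def1; unfold minus, plus, opp; simpl; lra.
  + intros P [Hx Hy]. split; simpl; lra.
- intros [x y] [Hx Hy]. simpl in Hx, Hy.
  destruct (Hu (-1 * x, y)) as [lx [ly [H1 [H2 H3]]]]; [split; simpl; lra|].
  exists (-1 * (-1 * lx)), ly. split; [|split; [exact H2|lra]].
  apply (second_derivative_comp_scal (fun t => u (t, y)) (-1) x lx H1).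
- assert (A : forall P n, outward_normal 1 1 (-1 * fst P, snd P) (-1 * fst n, snd n) ->
    is_normal_derivative (fun P => u (-1 * fst P, snd P)) P n (t * u (-1 * fst P, snd P))).
  { intros P n Hn. apply filterlim_ext with (2 := Bu _ _ Hn).
    intros h. simpl. do 3 f_equal. f_equal. ring. }
  intros P n Hn. apply A. destruct Hn; simpl.
  + replace (-1 * 1) with (- (1)) by ring. now apply normal_left.
  + replace (-1 * - (1)) with 1 by ring. replace (-1 * -1) with 1 by ring.
    now apply normal_right.
  + replace (-1 * 0) with 0 by ring. apply normal_top. lra.
  + replace (-1 * 0) with 0 by ring. apply normal_bottom. lra.
Qed.

(** * Hyperbolic and trigonometric estimates *)

Lemma cosh_ge1 (x : R) : 1 <= cosh x.
Proof.
unfold cosh. rewrite exp_Ropp.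
assert (E := exp_pos x). assert (H := Rinv_r (exp x) ltac:(lra)).
assert (I := Rinv_0_lt_compat _ E).
set (y := / exp x) in *. assert (S := pow2_ge_0 (exp x - y)). nra.
Qed.

Lemma sinh_opp (x : R) : sinh (- x) = - sinh x.
Proof. unfold sinh. rewrite Ropp_involutive. field. Qed.

Lemma cosh_opp (x : R) : cosh (- x) = cosh x.
Proof. unfold cosh. rewrite Ropp_involutive. field. Qed.

Lemma sinh_pos (x : R) : 0 < x -> 0 < sinh x.
Proof. intros H. unfold sinh. assert (exp (- x) < exp x) by (apply exp_increasing; lra). lra. Qed.

Lemma is_derive_cosh (x : R) : is_derive cosh x (sinh x).
Proof. unfold sinh, cosh. auto_derive; [easy|]. field. Qed.

Lemma cosh2_sinh2 (x : R) : cosh x * cosh x - sinh x * sinh x = 1.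
Proof.
unfold cosh, sinh. rewrite exp_Ropp. assert (E := exp_pos x). field. lra.
Qed.

Lemma second_derivative_of (f f' : R -> R) (x l : R) :
  (forall t, is_derive f t (f' t)) -> is_derive f' x l -> second_derivative f x l.
Proof.
intros H1 H2. exists f'. split; [|exact H2]. apply filter_forall. exact H1.
Qed.

Lemma is_derive_sin_affine (A m b x : R) :
  is_derive (fun t => A * sin (m * t + b)) x (A * (m * cos (m * x + b))).
Proof. auto_derive; [easy|]. ring. Qed.

Lemma second_derivative_sin_affine (A m b x : R) :
  second_derivative (fun t => A * sin (m * t + b)) x (- (m * m) * (A * sin (m * x + b))).
Proof.
apply second_derivative_of with (fun t => A * (m * cos (m * t + b))).
- intros t. apply is_derive_sin_affine.
- auto_derive; [easy|]. ring.
Qed.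

Lemma is_derive_cosh_scal (A m x : R) :
  is_derive (fun t => A * cosh (m * t)) x (A * (m * sinh (m * x))).
Proof. unfold cosh, sinh. auto_derive; [easy|]. field. Qed.

Lemma second_derivative_cosh_scal (A m x : R) :
  second_derivative (fun t => A * cosh (m * t)) x (m * m * (A * cosh (m * x))).
Proof.
apply second_derivative_of with (fun t => A * (m * sinh (m * t))).
- intros t. apply is_derive_cosh_scal.
- unfold cosh, sinh. auto_derive; [easy|]. field.
Qed.

Lemma exp_1_bounds : 9 / 4 <= exp 1 <= 3.
Proof.
split; [|apply exp_le_3].
assert (H : 3 / 2 < exp (1 / 2)).
{ apply Rle_lt_trans with (1 + 1 / 2); [lra|]. apply exp_ineq1. lra. }
replace 1 with (1 / 2 + 1 / 2) by lra. rewrite exp_plus. nra.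
Qed.

Lemma cos_1_le : cos 1 <= 13 / 24.
Proof.
assert (P := PI2_3_2).
destruct (cos_bound 1 0) as [_ H]; [lra|lra|].
unfold cos_approx, cos_term in H. simpl in H. lra.
Qed.

Lemma sin_1_ge : 5 / 6 <= sin 1.
Proof.
assert (P := PI2_3_2).
destruct (sin_bound 1 0) as [H _]; [lra|lra|].
unfold sin_approx, sin_term in H. simpl in H. lra.
Qed.

(* Then [a * tanh a] is the first nonzero eigenvalue of [-1, 1]^2. *)
Definition critical (a : R) : Prop := 0 < a < 1 /\ cos a * cosh a = sin a * sinh a.

(** The difference of the two sides changes sign between 0 and 1; its sign at 1 follows from
    rational bounds on [exp 1], [cos 1] and [sin 1]. *)
Lemma critical_exists : exists a, critical a.
Proof.
set (f := fun x => sin x * sinh x - cos x * cosh x).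
assert (C : continuity f).
{ intros x. apply derivable_continuous_pt. exists (Derive f x). apply is_derive_Reals.
  apply Derive_correct. unfold f, sinh, cosh. now auto_derive. }
assert (f0 : f 0 < 0).
{ unfold f. rewrite sin_0, cos_0. assert (H := cosh_ge1 0). lra. }
assert (f1 : 0 < f 1).
{ unfold f. assert (c1 := cos_1_le). assert (s1 := sin_1_ge).
  unfold sinh, cosh. rewrite exp_Ropp. destruct exp_1_bounds as [E1 E2].
  set (x := exp 1) in *. set (y := / x).
  assert (xy : x * y = 1) by (apply Rinv_r; lra).
  assert (y0 : 0 < y) by (apply Rinv_0_lt_compat; lra).
  assert (y1 : y <= 4 / 9) by nra.
  assert (cos 1 * ((x + y) / 2) <= 13 / 24 * ((x + y) / 2))
    by (apply Rmult_le_compat_r; lra).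
  assert (5 / 6 * ((x - y) / 2) <= sin 1 * ((x - y) / 2))
    by (apply Rmult_le_compat_r; lra).
  lra. }
destruct (IVT f 0 1 C ltac:(lra) f0 f1) as [a [Ha Hf]].
assert (a <> 0) by (intros ->; lra). assert (a <> 1) by (intros ->; lra).
exists a. unfold f in Hf. split; lra.
Qed.

Lemma cosh_le (x y : R) : 0 <= x <= y -> cosh x <= cosh y.
Proof.
intros [Hx [Hxy| ->]]; [|lra].
destruct (MVT_cor2 cosh sinh x y Hxy) as [c [E Hc]].
- intros c _. apply is_derive_Reals, is_derive_cosh.
- assert (H := sinh_pos c ltac:(lra)). nra.
Qed.

(** Criticality reads [cos a = sin a * tanh a], and [tanh a < 1] gives [cos a < sin a]. *)
Lemma critical_sin_cos (a : R) :
  critical a -> 0 < sin a /\ 0 < cos a /\ cos a * cos a < 1 / 2.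
Proof.
intros [Ha E]. assert (P := PI2_3_2).
assert (s0 : 0 < sin a) by (apply sin_gt_0; lra).
assert (c0 : 0 < cos a) by (apply cos_gt_0; lra).
split; [exact s0|split; [exact c0|]].
assert (C := cosh_ge1 a). assert (S := sinh_pos a ltac:(lra)).
assert (I := cosh2_sinh2 a). assert (J := sin2_cos2 a). unfold Rsqr in J.
assert (sinh a < cosh a) by nra.
assert (cos a < sin a) by nra. nra.
Qed.

(** * Symmetry below the critical value *)

Lemma continuous_gt_left (g : R -> R) (a c : R) :
  continuous g a -> c < g a -> 0 < a -> exists b, 0 < b < a /\ c < g b.
Proof.
intros Hg H a0. destruct (Hg _ (open_gt c _ H)) as [d Hd].
assert (d0 := cond_pos d).
assert (M1 := Rmin_l (d / 2) (a / 2)). assert (M2 := Rmin_r (d / 2) (a / 2)).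
assert (0 < Rmin (d / 2) (a / 2)) by (apply Rmin_glb_lt; lra).
exists (a - Rmin (d / 2) (a / 2)). split; [lra|].
apply Hd. apply Rabs_def1; unfold minus, plus, opp; simpl; lra.
Qed.

(* Slightly slower growth than at the critical parameter leaves room for a
   strictly superharmonic comparison function. *)
Lemma subcritical_exists (a t : R) :
  critical a -> t * cosh a < a * sinh a ->
  exists nu, 0 < nu < a /\ t * cosh nu < nu * sinh nu.
Proof.
intros [Ha _] Ht.
destruct (continuous_gt_left (fun x => x * sinh x - t * cosh x) a 0) as [nu [H1 H2]].
- apply (ex_derive_continuous (fun x => x * sinh x - t * cosh x)).
  unfold sinh, cosh. now auto_derive.
- lra.
- lra.
- exists nu. split; [exact H1|lra].
Qed.

(** At a critical [a] the hypothesis reads [t < a cot a], which survives a small phase shift. The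
    shift makes [sin (a * x + h)] at least [sin h > 0] on the half-square, where the unshifted sine
    vanishes at [x = 0]. *)
Lemma subcritical_phase_exists (a t : R) :
  critical a -> t * cosh a < a * sinh a ->
  exists h, 0 < h < 1 /\ a + h < PI / 2 /\ t * sin (a + h) < a * cos (a + h).
Proof.
intros Ca Ht. destruct (critical_sin_cos a Ca) as [s0 [c0 _]].
destruct Ca as [Ha E]. assert (P := PI2_3_2).
assert (C := cosh_ge1 a).
assert (H : t * sin a < a * cos a).
{ apply Rmult_lt_reg_r with (cosh a); [lra|].
  replace (a * cos a * cosh a) with (a * (cos a * cosh a)) by ring. rewrite E. nra. }
assert (K : continuous (fun x => a * cos (a + x) - t * sin (a + x)) 0).
{ apply (ex_derive_continuous (fun x => a * cos (a + x) - t * sin (a + x))).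
  now auto_derive. }
assert (K0 : 0 < a * cos (a + 0) - t * sin (a + 0)) by (rewrite Rplus_0_r; lra).
destruct (K _ (open_gt 0 _ K0)) as [d Hd]. assert (d0 := cond_pos d).
assert (M1 := Rmin_l (d / 2) (Rmin (1 / 2) ((PI / 2 - a) / 2))).
assert (M2 := Rmin_r (d / 2) (Rmin (1 / 2) ((PI / 2 - a) / 2))).
assert (M3 := Rmin_l (1 / 2) ((PI / 2 - a) / 2)).
assert (M4 := Rmin_r (1 / 2) ((PI / 2 - a) / 2)).
set (h := Rmin (d / 2) _) in *.
assert (h0 : 0 < h) by (repeat apply Rmin_glb_lt; lra).
exists h. split; [lra|split; [lra|]].
assert (B : ball 0 d h) by (apply Rabs_def1; unfold minus, plus, opp; simpl; lra).
specialize (Hd h B). simpl in Hd. lra.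
Qed.

Lemma odd_part_nonpos (a t : R) (u : R * R -> R) :
  critical a -> t * cosh a < a * sinh a -> steklov_core t u ->
  (forall y, -1 <= y <= 1 -> u (0, y) <= 0) ->
  forall P, 0 <= fst P <= 1 /\ -1 <= snd P <= 1 -> u P <= 0.
Proof.
intros Ca Ht [Cu Hu Bu] U0.
destruct (subcritical_exists a t Ca Ht) as [nu [Hnu Tnu]].
destruct (subcritical_phase_exists a t Ca Ht) as [h [Hh [Hah Th]]].
destruct Ca as [Ha _]. assert (P2 := PI2_3_2).
set (s0 := sin h). assert (Hs0 : 0 < s0) by (apply sin_gt_0; lra).
(* The margins of the supersolution [v0]: [s0] for its size, [m1] on the side [x = 1], [m2] on the
   horizontal sides, and [m3] for its Laplacian, which is [- m3 * v0]. *)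
set (m1 := a * cos (a + h) - t * sin (a + h)).
set (m2 := nu * sinh nu - t * cosh nu).
set (m3 := a * a - nu * nu).
assert (Hm1 : 0 < m1) by (unfold m1; lra).
assert (Hm2 : 0 < m2) by (unfold m2; lra).
assert (Hm3 : 0 < m3) by (unfold m3; nra).
set (d := Rmin (Rmin s0 m1) (Rmin (m2 * s0) (m3 * s0))).
assert (d0 : 0 < d) by (repeat apply Rmin_glb_lt; try assumption; nra).
assert (d1 : d <= s0) by (eapply Rle_trans; apply Rmin_l).
assert (d2 : d <= m1) by (eapply Rle_trans; [apply Rmin_l|apply Rmin_r]).
assert (d3 : d <= m2 * s0) by (eapply Rle_trans; [apply Rmin_r|apply Rmin_l]).
assert (d4 : d <= m3 * s0) by (eapply Rle_trans; [apply Rmin_r|apply Rmin_r]).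
assert (Hsin : forall x, 0 <= x <= 1 -> s0 <= sin (a * x + h)).
{ intros x Hx. apply sin_incr_1; nra. }
set (v0 := fun P : R * R => sin (a * fst P + h) * cosh (nu * snd P)).
assert (Hv : forall P, 0 <= fst P <= 1 /\ -1 <= snd P <= 1 -> s0 <= v0 P).
{ intros P [Hx _]. unfold v0. assert (A := Hsin _ Hx).
  assert (B := cosh_ge1 (nu * snd P)). nra. }
apply (comparison 0 t d u v0); try assumption; try lra.
- intros P [HP1 HP2] S HS. specialize (Cu P ltac:(split; lra) S HS). revert Cu.
  unfold filtermap, within. apply filter_imp. intros Q H [HQ1 HQ2]. apply H. split; lra.
- intros P HP1 HP2. apply Hu. split; lra.
- right. intros [x y] [_ HP] E. simpl in E, HP. subst x. now apply U0.
- intros P n Hn _ _. exists (t * u P). split; [now apply Bu|lra].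
- intros P HP. split; [|specialize (Hv P HP); lra].
  unfold v0. prove_continuous.
- intros [x y] HP1 HP2. simpl in HP1, HP2.
  exists (- (a * a) * v0 (x, y) + nu * nu * v0 (x, y)). split.
  + exists (- (a * a) * v0 (x, y)), (nu * nu * v0 (x, y)). split; [|split; [|reflexivity]].
    * assert (A := second_derivative_sin_affine (cosh (nu * y)) a h x).
      unfold v0. simpl. rewrite Rmult_comm with (r1 := sin _).
      destruct A as [g [A1 A2]]. exists g. split; [|exact A2]. revert A1.
      apply filter_imp. intros s. apply is_derive_ext. intros r. apply Rmult_comm.
    * apply (second_derivative_cosh_scal (sin (a * x + h)) nu y).
  + specialize (Hv (x, y) ltac:(simpl; lra)). fold v0. unfold m3 in d4. unfold m3 in Hm3.
    assert ((a * a - nu * nu) * s0 <= (a * a - nu * nu) * v0 (x, y))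
      by (apply Rmult_le_compat_l; lra). lra.
- intros P n Hn KP.
  exists (cosh (nu * snd P) * (a * cos (a * fst P + h)) * fst n
          + sin (a * fst P + h) * (nu * sinh (nu * snd P)) * snd n). split.
  + apply is_normal_derivative_partials with 1 1; [| |exact Hn].
    * apply is_derive_ext with (fun s => cosh (nu * snd P) * sin (a * s + h)).
      -- intros s. apply Rmult_comm.
      -- apply is_derive_sin_affine.
    * apply (is_derive_cosh_scal (sin (a * fst P + h)) nu).
  + unfold v0. destruct KP as [Kx Ky]. assert (A := Hsin _ Kx). revert Kx Ky A.
    destruct Hn as [y Hy|y Hy|x Hx|x Hx]; simpl; intros Kx Ky A.
    * rewrite Rmult_1_r. assert (B := cosh_ge1 (nu * y)). fold m1.
      assert (m1 * 1 <= m1 * cosh (nu * y)) by (apply Rmult_le_compat_l; lra).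
      unfold m1 in *. lra.
    * lra.
    * rewrite Rmult_1_r.
      assert (m2 * s0 <= m2 * sin (a * x + h)) by (apply Rmult_le_compat_l; lra).
      unfold m2 in *. lra.
    * replace (nu * - (1)) with (- nu) by ring. rewrite sinh_opp, cosh_opp.
      assert (m2 * s0 <= m2 * sin (a * x + h)) by (apply Rmult_le_compat_l; lra).
      unfold m2 in *. lra.
Qed.

Lemma subcritical_even (a t : R) (u : R * R -> R) :
  critical a -> t * cosh a < a * sinh a -> steklov_core t u ->
  forall P, closed_rect 1 1 P -> u (- fst P, snd P) = u P.
Proof.
intros Ca Ht Hu.
set (v := fun P : R * R => 1 * u P + (-1) * u (-1 * fst P, snd P)).
assert (Hv : steklov_core t v).
{ apply steklov_core_lincomb; [exact Hu|now apply steklov_core_reflect]. }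
assert (V0 : forall y, v (0, y) = 0).
{ intros y. unfold v. simpl. rewrite Rmult_0_r. ring. }
assert (A := odd_part_nonpos a t v Ca Ht Hv (fun y _ => Req_le _ _ (V0 y))).
assert (V1 : forall y, (-1) * v (0, y) + 0 * v (0, y) = 0) by (intros y; rewrite V0; ring).
assert (B := odd_part_nonpos a t _ Ca Ht (steklov_core_opp t v Hv)
               (fun y _ => Req_le _ _ (V1 y))).
assert (H : forall x y, 0 <= x <= 1 -> -1 <= y <= 1 -> u (- x, y) = u (x, y)).
{ intros x y Hx Hy. specialize (A (x, y) (conj Hx Hy)). specialize (B (x, y) (conj Hx Hy)).
  unfold v in A, B. simpl in A, B. replace (-1 * x) with (- x) in * by ring. lra. }
intros [x y] [Hx Hy]. simpl in *. destruct (Rle_lt_dec 0 x).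
- apply H; lra.
- symmetry. rewrite <- (Ropp_involutive x) at 1. apply H; lra.
Qed.

(** * Inflow at the boundary and change of sign *)

Lemma comparison_inflow (f : R * R -> R) (g : R) :
  0 < g -> continuous_on (closed_rect 1 1) f ->
  (forall P, open_rect 1 1 P -> laplacian_value f P 0) ->
  (forall P n, outward_normal 1 1 P n -> 0 < f P ->
     exists l, is_normal_derivative f P n l /\ l <= - g * f P) ->
  forall P, closed_rect 1 1 P -> f P <= 0.
Proof.
intros g0 Cf Hf Bf P HP.
(* With [T = - g] a nearly constant function is a supersolution: [v0] below has Laplacian [- 4 * e]
   and normal derivative [- 2 * e], and [e <= g / 8] keeps the latter above [- g * v0 + d]. *)
set (e := Rmin (1 / 4) (g / 8)).
assert (e0 : 0 < e) by (apply Rmin_glb_lt; lra).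
assert (e1 : e <= 1 / 4) by apply Rmin_l. assert (e2 : e <= g / 8) by apply Rmin_r.
set (d := Rmin (1 / 2) (Rmin (4 * e) (g / 4))).
assert (d0 : 0 < d) by (repeat apply Rmin_glb_lt; lra).
assert (d1 : d <= 1 / 2) by apply Rmin_l.
assert (d2 : d <= 4 * e) by (eapply Rle_trans; [apply Rmin_r|apply Rmin_l]).
assert (d3 : d <= g / 4) by (eapply Rle_trans; [apply Rmin_r|apply Rmin_r]).
set (v0 := fun P : R * R => 1 - e * (fst P ^ 2 + snd P ^ 2)).
assert (Hv : forall P, -1 <= fst P <= 1 /\ -1 <= snd P <= 1 -> 1 / 2 <= v0 P).
{ intros [x y] [Hx Hy]. unfold v0. simpl fst in *; simpl snd in *.
  assert (x ^ 2 <= 1) by nra. assert (y ^ 2 <= 1) by nra. nra. }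
assert (K : forall Q : R * R, -1 <= fst Q <= 1 /\ -1 <= snd Q <= 1 -> closed_rect 1 1 Q)
  by (intros Q [H1 H2]; split; lra).
apply (comparison (-1) (- g) d f v0); [lra|exact d0|..].
- intros Q HQ S HS. specialize (Cf Q (K Q HQ) S HS). revert Cf.
  unfold filtermap, within. apply filter_imp. intros R0 H HR. apply H, K, HR.
- intros Q H1 H2. apply Hf. split; lra.
- now left.
- intros Q n Hn _ fQ. now apply Bf.
- intros Q HQ. split; [|specialize (Hv Q HQ); lra]. unfold v0. prove_continuous.
- intros [x y] _ _. exists (- 2 * e + - 2 * e). split; [|lra].
  exists (- 2 * e), (- 2 * e). split; [|split; [|reflexivity]].
  + apply second_derivative_of with (fun s => - 2 * e * s); unfold v0; simpl;
      [intros s|]; auto_derive; trivial; ring.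
  + apply second_derivative_of with (fun s => - 2 * e * s); unfold v0; simpl;
      [intros s|]; auto_derive; trivial; ring.
- intros Q n Hn KQ.
  exists (- 2 * e * fst Q * fst n + - 2 * e * snd Q * snd n). split.
  + apply is_normal_derivative_partials with 1 1; [| |exact Hn];
      unfold v0; simpl; auto_derive; trivial; ring.
  + specialize (Hv Q KQ).
    assert (A : - 2 * e * fst Q * fst n + - 2 * e * snd Q * snd n = - 2 * e)
      by (destruct Hn; simpl; ring).
    rewrite A. nra.
- destruct HP. split; lra.
Qed.

Lemma compact_continuous_max {T : UniformSpace} (K : T -> Prop) (f : T -> R) :
  compact_set K -> (exists t, K t) -> continuous_on K f ->
  exists t, K t /\ forall x, K x -> f x <= f t.
Proof.
intros HK He Hf. apply (compact_usc_max K f HK He).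
intros t Kt c Hc. now apply continuous_on_lt.
Qed.

Lemma compact_closed_rect (p q : R) : compact_set (closed_rect p q).
Proof.
apply (compact_prod (fun x => - p <= x <= p) (fun y => - q <= y <= q));
apply compact_segment.
Qed.

Lemma steklov_core_neg_zero (t : R) (u : R * R -> R) :
  steklov_core t u -> t < 0 -> forall P, closed_rect 1 1 P -> u P = 0.
Proof.
intros Hu t0 P HP. apply Rle_antisym.
- apply (comparison_inflow u (- t)); [lra|apply Hu|apply Hu| |exact HP].
  intros Q n Hn _. exists (t * u Q). split; [now apply Hu|lra].
- set (v := fun P => (-1) * u P + 0 * u P).
  assert (Hv : steklov_core t v) by now apply steklov_core_opp.
  assert (v P <= 0); [|unfold v in *; lra].
  apply (comparison_inflow v (- t)); [lra|apply Hv|apply Hv| |exact HP].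
  intros Q n Hn _. exists (t * v Q). split; [now apply Hv|lra].
Qed.

(* Otherwise -u has strictly negative normal derivative everywhere. *)
Lemma steklov_core_not_positive (t m : R) (u : R * R -> R) :
  steklov_core t u -> 0 < t -> 0 < m ->
  (forall P n, outward_normal 1 1 P n -> m <= u P) -> False.
Proof.
intros [Cu Hu Bu] t0 m0 Hm.
set (f := fun P => (-1) * u P + 1 * (u (0, 0) + 1)).
assert (O : closed_rect 1 1 (0, 0)) by (split; simpl; lra).
assert (Cf : continuous_on (closed_rect 1 1) f).
{ apply continuous_on_lincomb; [exact Cu|].
  apply continuous_on_forall. intros. apply continuous_const. }
destruct (compact_continuous_max _ f (compact_closed_rect 1 1)) as [R0 [KR HR]];
  [now exists (0, 0)|exact Cf|].
assert (f0 : f (0, 0) = 1) by (unfold f; ring).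
assert (fR : 1 <= f R0) by (rewrite <- f0; now apply HR).
assert (H : f (0, 0) <= 0); [|lra].
(* On the sides [f] has normal derivative [- t * u <= - t * m]; dividing by the maximum [f R0] makes
   this bound proportional to [f]. *)
apply (comparison_inflow f (t * m / f R0)).
- apply Rdiv_lt_0_compat; nra.
- exact Cf.
- intros P HP. replace 0 with ((-1) * 0 + 1 * 0) by ring.
  apply laplacian_value_lincomb; [now apply Hu|apply laplacian_value_const].
- intros P n Hn fP. exists ((-1) * (t * u P) + 1 * 0). split.
  + apply is_normal_derivative_lincomb; [now apply Bu|apply is_normal_derivative_const].
  + assert (fPR : f P <= f R0).
    { apply HR. destruct (outward_normal_gauge P n Hn) as [Hx [Hy _]]. split; lra. }
    assert (m <= u P) by now apply (Hm P n).
    assert (t * m / f R0 * f P <= t * m).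
    { apply Rle_trans with (t * m / f R0 * f R0).
      - apply Rmult_le_compat_l; [|exact fPR].
        apply Rlt_le, Rdiv_lt_0_compat; nra.
      - apply Req_le. field. lra. }
    nra.
- exact O.
Qed.

(** * Contraction of the increments *)

Lemma cosh_abs_le (x y : R) : - y <= x <= y -> cosh x <= cosh y.
Proof.
intros H. destruct (Rle_lt_dec 0 x).
- apply cosh_le. lra.
- rewrite <- cosh_opp. apply cosh_le. lra.
Qed.

(* A coefficient below 1 (here 19 / 20) keeps the comparison function
   [cos (a z) - 19 / 20 cos (a x)] positive on the faces z = x and z = -x. *)
Definition increment_ratio (a : R) : R :=
  sinh a * (1 - 19 / 20 * cos a) / (19 / 20 * sin a).

(** Multiplying by [sin a] lets criticality replace [sin a * sinh a] by [cos a * cosh a]. The upper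
    bound then depends on [cos a] alone, through [cosh a <= cosh 1 <= 5 / 3], and holds for
    [cos a < 71 / 100], slightly above the square root of one half. *)
Lemma increment_ratio_bounds (a : R) : critical a -> 0 < increment_ratio a < 1.
Proof.
intros Ca. destruct (critical_sin_cos a Ca) as [s0 [c0 c2]].
destruct Ca as [Ha E]. assert (S := sinh_pos a ltac:(lra)).
assert (C1 : cosh a <= 5 / 3).
{ apply Rle_trans with (cosh 1); [apply cosh_le; lra|].
  unfold cosh. rewrite exp_Ropp. destruct exp_1_bounds as [E1 E2].
  set (x := exp 1) in *. set (y := / x).
  assert (xy : x * y = 1) by (apply Rinv_r; lra).
  assert (y0 : 0 < y) by (apply Rinv_0_lt_compat; lra). nra. }
assert (J := sin2_cos2 a). unfold Rsqr in J.
assert (cos a < 1) by nra.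
unfold increment_ratio. split.
- apply Rdiv_lt_0_compat; [apply Rmult_lt_0_compat|]; lra.
- apply Rmult_lt_reg_r with (19 / 20 * sin a * sin a); [nra|].
  replace (sinh a * (1 - 19 / 20 * cos a) / (19 / 20 * sin a) * (19 / 20 * sin a * sin a))
    with ((sin a * sinh a) * (1 - 19 / 20 * cos a)) by (field; lra).
  rewrite <- E, Rmult_1_l.
  assert (cos a * cosh a * (1 - 19 / 20 * cos a)
          <= cos a * (5 / 3) * (1 - 19 / 20 * cos a)).
  { apply Rmult_le_compat_r; [lra|]. apply Rmult_le_compat_l; lra. }
  assert (cos a < 71 / 100) by nra.
  replace (19 / 20 * sin a * sin a) with (19 / 20 * (1 - cos a * cos a)) by nra.
  nra.
Qed.

Lemma increment_le (a t M : R) (u : R * R -> R) :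
  critical a -> t * cosh a < a * sinh a -> 0 < t -> steklov_core t u ->
  (forall P, closed_rect 1 1 P -> u (- fst P, snd P) = u P) ->
  0 < M -> (forall y, -1 < y < 1 -> u (1, y) <= M) ->
  forall x y z, x <= 1 -> -1 <= y <= 1 -> - x <= z <= x ->
  u (x, y) - u (z, y) <= increment_ratio a * M.
Proof.
intros Ca Ht t0 Hu Heven M0 HM.
destruct (critical_sin_cos a Ca) as [s0 [c0 c2]].
destruct (subcritical_exists a t Ca Ht) as [nu [Hnu Tnu]].
destruct Ca as [Ha E]. assert (P2 := PI2_3_2).
assert (J := sin2_cos2 a). unfold Rsqr in J. assert (c1 : cos a < 1) by nra.
assert (S := sinh_pos a ltac:(lra)). assert (C := cosh_ge1 a).
set (th := 19 / 20).
(* [A] makes the flux through [x = 1] equal to [M * a * tanh a] at [y = 0], which exceeds [t * M]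
   because [t < a * tanh a]. *)
set (A := M * (sinh a / cosh a) / (th * sin a)).
assert (A0 : 0 < A).
{ apply Rdiv_lt_0_compat; [|unfold th; lra].
  apply Rmult_lt_0_compat; [exact M0|]. apply Rdiv_lt_0_compat; lra. }
assert (EA : A * th * a * sin a = M * (a * sinh a / cosh a)).
{ unfold A, th. field. split; lra. }
assert (T1 : t < a * sinh a / cosh a).
{ apply Rmult_lt_reg_r with (cosh a); [lra|].
  replace (a * sinh a / cosh a * cosh a) with (a * sinh a) by (field; lra). exact Ht. }
set (k := A * ((1 - th) * cos a)).
assert (k0 : 0 < k) by (unfold k, th; apply Rmult_lt_0_compat; nra).
set (m1 := M * (a * sinh a / cosh a - t)).
set (m2 := nu * sinh nu - t * cosh nu).
set (m3 := a * a - nu * nu).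
assert (Hm1 : 0 < m1) by (apply Rmult_lt_0_compat; lra).
assert (Hm2 : 0 < m2) by (unfold m2; lra).
assert (Hm3 : 0 < m3) by (unfold m3; nra).
set (d := Rmin (Rmin k m1) (Rmin (m2 * k) (m3 * k))).
assert (d0 : 0 < d) by (repeat apply Rmin_glb_lt; try assumption; nra).
assert (d1 : d <= k) by (eapply Rle_trans; apply Rmin_l).
assert (d2 : d <= m1) by (eapply Rle_trans; [apply Rmin_l|apply Rmin_r]).
assert (d3 : d <= m2 * k) by (eapply Rle_trans; [apply Rmin_r|apply Rmin_l]).
assert (d4 : d <= m3 * k) by (eapply Rle_trans; [apply Rmin_r|apply Rmin_r]).
assert (Cle : forall x z, x <= 1 -> - x <= z <= x -> cos a <= cos (a * x) <= cos (a * z)).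
{ intros x z Hx Hz. split.
  - apply cos_decr_1; nra.
  - assert (forall z', 0 <= z' <= x -> cos (a * x) <= cos (a * z'))
      by (intros z' Hz'; apply cos_decr_1; nra).
    destruct (Rle_lt_dec 0 z); [apply H; lra|].
    replace (a * z) with (- (a * - z)) by ring. rewrite cos_neg. apply H; lra. }
set (r := fun x z => A * (cos (a * z) - th * cos (a * x))).
assert (Hr : forall x z, x <= 1 -> - x <= z <= x ->
  k <= r x z <= A * (1 - th * cos a)).
{ intros x z Hx Hz. destruct (Cle x z Hx Hz) as [H1 H2].
  assert (B := COS_bound (a * z)). unfold k, r, th.
  split; (apply Rmult_le_compat_l; [lra|]); nra. }
set (v0 := fun P : (R * R) * R => r (fst (fst P)) (snd P) * cosh (nu * snd (fst P))).
assert (Hv : forall P, wedge P -> k <= v0 P).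
{ intros [[x y] z] [[Hx Hy] Hz]. simpl in *. unfold v0; simpl.
  destruct (Hr x z ltac:(lra) Hz) as [H1 _].
  assert (B := cosh_ge1 (nu * y)). nra. }
assert (Inc : forall P, wedge P -> u (fst P) - u (snd P, snd (fst P)) <= v0 P).
{ apply (increment_comparison t M d u v0); try assumption.
  - intros P WP. split; [|specialize (Hv P WP); lra].
    unfold v0, r. prove_continuous.
  - intros [[x y] z] W. simpl.
    exists (a * a * (A * (th * cos (a * x)) * cosh (nu * y))),
      (nu * nu * v0 ((x, y), z)), (- (a * a) * (A * cos (a * z) * cosh (nu * y))).
    split; [|split; [|split]].
    + unfold v0, r; simpl.
      apply second_derivative_of
        with (fun s => A * (a * (th * sin (a * s))) * cosh (nu * y));
        [intros s|]; (auto_derive; [trivial|ring]).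
    + apply (second_derivative_cosh_scal (r x z) nu y).
    + unfold v0, r; simpl.
      apply second_derivative_of
        with (fun s => A * - (a * sin (a * s)) * cosh (nu * y));
        [intros s|]; (auto_derive; [trivial|ring]).
    + specialize (Hv _ W).
      assert (m3 * k <= m3 * v0 ((x, y), z)) by (apply Rmult_le_compat_l; lra).
      assert (a * a * (A * (th * cos (a * x)) * cosh (nu * y))
              + - (a * a) * (A * cos (a * z) * cosh (nu * y))
              = - (a * a) * v0 ((x, y), z)) by (unfold v0, r; simpl; ring).
      unfold m3 in *. lra.
  - intros y z Hy Hz.
    assert (B := cosh_ge1 (nu * y)).
    assert (G : 0 < M * (a * sinh a / cosh a)).
    { apply Rmult_lt_0_compat; [exact M0|]. lra. }
    exists (A * th * a * sin a * cosh (nu * y)).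
    split; [|split].
    + replace (A * th * a * sin a * cosh (nu * y))
        with (A * th * a * sin (a * 1) * cosh (nu * y) * fst (1, 0)
              + r 1 z * (nu * sinh (nu * y)) * snd (1, 0))
        by (simpl; rewrite (Rmult_1_r a); ring).
      apply is_normal_derivative_partials with 1 1.
      * unfold v0, r; simpl. auto_derive; [trivial|ring].
      * apply (is_derive_cosh_scal (r 1 z) nu y).
      * now apply normal_right.
    + rewrite EA. apply Rlt_le, Rmult_lt_0_compat; lra.
    + rewrite EA. unfold m1 in d2.
      assert (M * (a * sinh a / cosh a) * 1 <= M * (a * sinh a / cosh a) * cosh (nu * y))
        by (apply Rmult_le_compat_l; lra). lra.
  - intros [x y] n z Hn Hx W.
    destruct (Hr x z) as [H1 _]; [apply W|apply W|]. simpl in Hx.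
    assert (B : m2 * k <= m2 * r x z) by (apply Rmult_le_compat_l; lra).
    exists (A * (a * (th * sin (a * x))) * cosh (nu * y) * fst n
            + r x z * (nu * sinh (nu * y)) * snd n). split.
    + apply is_normal_derivative_partials with 1 1; [| |exact Hn].
      * unfold v0, r; simpl. auto_derive; [trivial|ring].
      * apply (is_derive_cosh_scal (r x z) nu y).
    + unfold v0. simpl. remember (x, y) as P eqn:EP. unfold m2 in *.
      destruct Hn as [y' Hy|y' Hy|x' Hx'|x' Hx']; injection EP as <- <-; simpl.
      * lra.
      * lra.
      * rewrite Rmult_1_r. nra.
      * replace (nu * - (1)) with (- nu) by ring. rewrite sinh_opp, cosh_opp. nra. }
intros x y z Hx Hy Hz.
apply Rle_trans with (v0 ((x, y), z)).
- apply (Inc ((x, y), z)). repeat split; simpl; lra.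
(* [v0] is largest when [cos (a * z)] is bounded by 1, [cos (a * x)] by [cos a] and [nu] by [a]; the
   factor [cosh a] cancels the one in [A], which is where [increment_ratio] comes from. *)
- unfold v0; simpl. destruct (Hr x z Hx Hz) as [H1 H2].
  assert (B : cosh (nu * y) <= cosh a) by (apply cosh_abs_le; nra).
  assert (B1 := cosh_ge1 (nu * y)).
  apply Rle_trans with (A * (1 - th * cos a) * cosh a).
  + apply Rmult_le_compat; lra.
  + apply Req_le. unfold A, increment_ratio. fold th. field. unfold th. split; lra.
Qed.

Lemma subcritical_zero (a t : R) (u : R * R -> R) :
  critical a -> t * cosh a < a * sinh a -> 0 < t -> steklov_core t u ->
  forall P, closed_rect 1 1 P -> u P = 0.
Proof.
intros Ca Ht t0 Hu.
assert (Ex := subcritical_even a t u Ca Ht Hu).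
assert (Hs := steklov_core_swap t u Hu).
assert (Ey := subcritical_even a t _ Ca Ht Hs). simpl in Ey.
assert (Hn := steklov_core_opp t u Hu). assert (Hns := steklov_core_swap t _ Hn).
assert (Enx := subcritical_even a t _ Ca Ht Hn).
assert (Eny := subcritical_even a t _ Ca Ht Hns). simpl in Eny, Enx.
assert (Ey' : forall x y, -1 <= x <= 1 -> -1 <= y <= 1 -> u (x, - y) = u (x, y)).
{ intros x y Hx Hy. apply (Ey (y, x)). split; simpl; lra. }
assert (Ex' : forall x y, -1 <= x <= 1 -> -1 <= y <= 1 -> u (- x, y) = u (x, y)).
{ intros x y Hx Hy. apply (Ex (x, y)). split; simpl; lra. }
destruct (increment_ratio_bounds a Ca) as [c0 c1]. set (c := increment_ratio a) in *.
(* By evenness two sides carry all boundary values; they meet at the corner [(1, 1)]. *)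
set (B := fun P : R * R => (fst P = 1 /\ -1 <= snd P <= 1) \/
                           (-1 <= fst P <= 1 /\ snd P = 1)).
assert (KB : compact_set B).
{ apply compact_union.
  - apply (compact_prod (fun x => x = 1) (fun y => -1 <= y <= 1));
      [apply compact_singleton|apply compact_segment].
  - apply (compact_prod (fun x => -1 <= x <= 1) (fun y => y = 1));
      [apply compact_segment|apply compact_singleton]. }
assert (Bsq : forall P, B P -> closed_rect 1 1 P).
{ intros P [[H1 H2]|[H1 H2]]; split; lra. }
assert (B1 : exists P, B P) by (exists (1, 1); left; simpl; lra).
assert (CB : forall v, steklov_core t v -> continuous_on B v).
{ intros v [Cv _ _] P BP. apply filterlim_within_subset with (closed_rect 1 1); auto. }
assert (Bd : forall P n, outward_normal 1 1 P n -> exists Q, B Q /\ u Q = u P).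
{ intros P n [y Hy|y Hy|x Hx|x Hx].
  - exists (1, y). split; [left; simpl; lra|reflexivity].
  - exists (1, y). split; [left; simpl; lra|]. symmetry. apply Ex'; lra.
  - exists (x, 1). split; [right; simpl; lra|reflexivity].
  - exists (x, 1). split; [right; simpl; lra|]. symmetry. apply Ey'; lra. }
destruct (compact_continuous_max B u KB B1 (CB u Hu)) as [P [BP HP]].
destruct (compact_continuous_max B _ KB B1 (CB _ Hn)) as [Q [BQ HQ]].
set (M := u P) in *. set (m := - u Q).
assert (HQ' : forall x, B x -> - m <= u x).
{ intros x Bx. specialize (HQ x Bx). unfold m. lra. }
assert (M0 : 0 <= M).
{ apply Rnot_lt_le. intros H.
  apply (steklov_core_not_positive t (- M) _ Hn t0); [lra|].
  intros R0 n Hn0. destruct (Bd R0 n Hn0) as [S [BS <-]]. specialize (HP S BS). lra. }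
assert (m0 : 0 <= m).
{ apply Rnot_lt_le. intros H.
  apply (steklov_core_not_positive t (- m) u Hu t0); [lra|].
  intros R0 n Hn0. destruct (Bd R0 n Hn0) as [S [BS <-]]. specialize (HQ' S BS). lra. }
(* The slack [z] supplies the strict positivity asked for by [increment_le], as [M] or [m] may be 0;
   it is made small at the end. *)
assert (Inc : forall z, 0 < z -> forall x y s, x <= 1 -> -1 <= y <= 1 -> - x <= s <= x ->
  - (c * (m + z)) <= u (x, y) - u (s, y) <= c * (M + z) /\
  - (c * (m + z)) <= u (y, x) - u (y, s) <= c * (M + z)).
{ intros z z0 x y s Hx Hy Hs0.
  assert (I1 := increment_le a t (M + z) u Ca Ht t0 Hu Ex ltac:(lra)).
  assert (I2 := increment_le a t (M + z) _ Ca Ht t0 Hs Ey ltac:(lra)).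
  assert (I3 := increment_le a t (m + z) _ Ca Ht t0 Hn Enx ltac:(lra)).
  assert (I4 := increment_le a t (m + z) _ Ca Ht t0 Hns Eny ltac:(lra)).
  fold c in I1, I2, I3, I4. simpl in I2, I4.
  assert (F1 : forall y0, -1 < y0 < 1 -> - m <= u (1, y0) <= M).
  { intros y0 Hy0. assert (b : B (1, y0)) by (left; simpl; lra).
    split; [now apply HQ'|now apply HP]. }
  assert (F2 : forall y0, -1 < y0 < 1 -> - m <= u (y0, 1) <= M).
  { intros y0 Hy0. assert (b : B (y0, 1)) by (right; simpl; lra).
    split; [now apply HQ'|now apply HP]. }
  specialize (I1 ltac:(intros y0 Hy0; specialize (F1 y0 Hy0); lra) x y s Hx Hy Hs0).
  specialize (I2 ltac:(intros y0 Hy0; specialize (F2 y0 Hy0); lra) x y s Hx Hy Hs0).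
  specialize (I3 ltac:(intros y0 Hy0; specialize (F1 y0 Hy0); lra) x y s Hx Hy Hs0).
  specialize (I4 ltac:(intros y0 Hy0; specialize (F2 y0 Hy0); lra) x y s Hx Hy Hs0).
  split; lra. }
(* From a boundary maximum to a boundary minimum one moves once outwards and
   once inwards, so that each of the two bounds is used at most once. *)
assert (Osc : forall z, 0 < z -> M + m <= c * (M + z) + c * (m + z)).
{ intros z z0. specialize (Inc z z0).
  assert (p1 : 0 < c * (M + z)) by (apply Rmult_lt_0_compat; lra).
  assert (p2 : 0 < c * (m + z)) by (apply Rmult_lt_0_compat; lra).
  assert (Abs : forall s, -1 <= s <= 1 -> 0 <= Rabs s <= 1 /\ - Rabs s <= s <= Rabs s /\
    u (1, Rabs s) = u (1, s) /\ u (Rabs s, 1) = u (s, 1)).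
  { intros s Hs0. unfold Rabs. destruct (Rcase_abs s).
    - repeat split; try lra; [apply Ey'|apply Ex']; lra.
    - repeat split; lra. }
  assert (Side : forall s1 s2, -1 <= s1 <= 1 -> -1 <= s2 <= 1 ->
    u (1, s1) - u (1, s2) <= c * (M + z) + c * (m + z) /\
    u (s1, 1) - u (s2, 1) <= c * (M + z) + c * (m + z)).
  { intros s1 s2 H1 H2.
    destruct (Abs s1 H1) as [A1 [A2 [A3 A4]]]. destruct (Abs s2 H2) as [A5 [A6 [A7 A8]]].
    destruct (Rle_lt_dec (Rabs s2) (Rabs s1)).
    - destruct (Inc (Rabs s1) 1 s2) as [J1 J2]; lra.
    - destruct (Inc (Rabs s2) 1 s1) as [J1 J2]; lra. }
  assert (Any : forall x1 y1 x2 y2 : R, B (x1, y1) -> B (x2, y2) ->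
    u (x1, y1) - u (x2, y2) <= c * (M + z) + c * (m + z)).
  { intros x1 y1 x2 y2 BP' BQ'.
    destruct BP' as [[H1 H2]|[H1 H2]], BQ' as [[H3 H4]|[H3 H4]];
      simpl in H1, H2, H3, H4.
    - rewrite H1, H3. now apply Side.
    - rewrite H1, H4.
      destruct (Inc 1 1 y1) as [_ J1]; [lra|lra|lra|].
      destruct (Inc 1 1 x2) as [J2 _]; [lra|lra|lra|]. lra.
    - rewrite H2, H3.
      destruct (Inc 1 1 y2) as [_ J1]; [lra|lra|lra|].
      destruct (Inc 1 1 x1) as [J2 _]; [lra|lra|lra|]. lra.
    - rewrite H2, H4. now apply Side. }
  assert (J : u P - u Q <= c * (M + z) + c * (m + z)).
  { destruct P as [x1 y1], Q as [x2 y2]. now apply Any. }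
  unfold M, m in *. lra. }
assert (Z : M + m <= 0).
{ apply Rnot_lt_le. intros H.
  assert (z0 : 0 < (1 - c) * (M + m) / 4) by nra.
  specialize (Osc _ z0). nra. }
assert (MZ : M = 0) by lra. assert (mZ : m = 0) by lra.
intros [x y] [Hx Hy]. simpl in Hx, Hy.
assert (bz : B (1, y)) by (left; simpl; lra).
assert (u1 : u (1, y) = 0).
{ apply Rle_antisym; [rewrite <- MZ; now apply HP|].
  specialize (HQ' _ bz). lra. }
assert (N : forall z, 0 < z -> - z <= u (x, y) <= z).
(* Interior values are reached by one increment from the side [x = 1], where [u] is now known to
   vanish. *)
{ intros z z0. destruct (Inc z z0 1 y x) as [J _]; [lra|lra|lra|].
  rewrite MZ, mZ, u1 in J. nra. }
apply Rle_antisym; apply Rnot_lt_le; intros H.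
- specialize (N (u (x, y) / 2)). lra.
- specialize (N (- u (x, y) / 2)). lra.
Qed.

Lemma steklov_core_lower_bound (a t : R) (u : R * R -> R) :
  critical a -> t <> 0 -> steklov_core t u ->
  (exists P, closed_rect 1 1 P /\ u P <> 0) -> a * sinh a <= t * cosh a.
Proof.
intros Ca tn Hu [P [HP uP]]. apply Rnot_lt_le. intros Ht. apply uP.
destruct (Rle_lt_dec t 0).
- apply (steklov_core_neg_zero t u Hu); [lra|exact HP].
- now apply (subcritical_zero a t u).
Qed.

(** * Eigenvalues of rectangles *)

Lemma second_derivative_Derive (f : R -> R) (x : R) :
  locally x (ex_derive f) -> ex_derive (Derive f) x ->
  second_derivative f x (Derive (Derive f) x).
Proof.
intros H1 H2. exists (Derive f). split.
- revert H1. apply filter_imp. intros t. apply Derive_correct.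
- now apply Derive_correct.
Qed.

Lemma locally_interval (a b x : R) (Q : R -> Prop) :
  a < x < b -> (forall t, a < t < b -> Q t) -> locally x Q.
Proof.
intros Hx HQ. generalize (filter_and _ _ (open_gt a x (proj1 Hx)) (open_lt b x (proj2 Hx))).
apply filter_imp. intros t [H1 H2]. apply HQ. now split.
Qed.

(** Rescaling to the unit square multiplies normal derivatives, hence the eigenvalue, by [r]. *)
Lemma steklov_core_of_eigenfunction (r sigma : R) (s : R * R -> R) :
  0 < r -> steklov_eigenfunction r r sigma s ->
  steklov_core (r * sigma) (fun P => s (r * fst P, r * snd P)) /\
  exists P, closed_rect 1 1 P /\ s (r * fst P, r * snd P) <> 0.
Proof.
intros r0 [[P [HP sP]] Cs [C1 [C2x C2y]] _ Hs Bs]. split; [split|].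
- apply (continuous_on_comp _ (closed_rect r r) (fun P => (r * fst P, r * snd P)));
    [exact Cs| |].
  + intros [x y] S [e He].
    assert (e0 := cond_pos e).
    exists (mkposreal _ (Rdiv_lt_0_compat _ _ e0 r0)). intros [x' y'] [Bx By].
    assert (A : forall a b : R, ball a (e / r) b -> ball (r * a) e (r * b)).
    { intros a b Hab. apply Rabs_def2 in Hab. unfold minus, plus, opp in Hab; simpl in Hab.
      assert (r * (e / r) = e) by (field; lra).
      apply Rabs_def1; unfold minus, plus, opp; simpl; nra. }
    apply He. split; [apply (A x x' Bx)|apply (A y y' By)].
  + intros [x y] [Hx Hy]. simpl in Hx, Hy. split; simpl; nra.
- intros [x y] [Hx Hy]. simpl in Hx, Hy.
  assert (HQ : open_rect r r (r * x, r * y)) by (split; simpl; nra).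
  exists (r * (r * partial_x (partial_x s) (r * x, r * y))),
         (r * (r * partial_y (partial_y s) (r * x, r * y))).
  specialize (Hs _ HQ). unfold laplacian in Hs.
  split; [|split].
  + apply (second_derivative_comp_scal (fun t => s (t, r * y))).
    apply (second_derivative_Derive (fun t => s (t, r * y))).
    * apply locally_interval with (- r) r; [exact (proj1 HQ)|]. intros t Ht.
      apply (C1 (t, r * y)). split; [exact Ht|exact (proj2 HQ)].
    * apply (C2x (r * x, r * y) HQ).
  + apply (second_derivative_comp_scal (fun t => s (r * x, t))).
    apply (second_derivative_Derive (fun t => s (r * x, t))).
    * apply locally_interval with (- r) r; [exact (proj2 HQ)|]. intros t Ht.
      apply (C1 (r * x, t)). split; [exact (proj1 HQ)|exact Ht].
    * apply (C2y (r * x, r * y) HQ).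
  + simpl. rewrite <- !Rmult_plus_distr_l, Hs. ring.
- intros Q n Hn.
  assert (On : outward_normal r r (r * fst Q, r * snd Q) n).
  { destruct Hn; simpl; rewrite ?Rmult_1_r, <- ?Ropp_mult_distr_r, ?Rmult_1_r.
    - apply normal_right. nra.
    - apply normal_left. nra.
    - apply normal_top. nra.
    - apply normal_bottom. nra. }
  (* The quotient of the rescaled function at [h] is [r] times that of [s] at [r * h], which also
     tends to 0 from the right. *)
  assert (L : filterlim (fun h => r * h) (at_right 0) (at_right 0)).
  { intros S [e He]. assert (e0 := cond_pos e).
    exists (mkposreal _ (Rdiv_lt_0_compat _ _ e0 r0)). intros h Bh h0.
    apply Rabs_def2 in Bh. unfold minus, plus, opp in Bh; simpl in Bh.
    assert (r * (e / r) = e) by (field; lra).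
    apply He; [|nra]. apply Rabs_def1; unfold minus, plus, opp; simpl; nra. }
  assert (F := filterlim_comp _ _ _ _ _ _ _ _ L (Bs _ n On)).
  assert (F' := filterlim_comp _ _ _ _ _ _ _ _ F (filterlim_scal_r r _)).
  replace (r * sigma * s (r * fst Q, r * snd Q))
    with (scal r (sigma * s (r * fst Q, r * snd Q))) by (unfold scal; simpl; unfold mult; simpl; ring).
  apply filterlim_within_ext with (2 := F').
  intros h h0. unfold scal; simpl; unfold mult; simpl.
  replace (r * fst Q - r * h * fst n) with (r * (fst Q - h * fst n)) by ring.
  replace (r * snd Q - r * h * snd n) with (r * (snd Q - h * snd n)) by ring.
  field. lra.
- exists (fst P / r, snd P / r). destruct P as [x y]. destruct HP as [Hx Hy]. simpl in *.
  replace (r * (x / r)) with x by (field; lra). replace (r * (y / r)) with y by (field; lra).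
  split; [|exact sP].
  assert (A : forall z, - r <= z <= r -> - (1) <= z / r <= 1).
  { intros z Hz. assert (z / r * r = z) by (field; lra).
    split; apply Rmult_le_reg_r with r; lra. }
  split; simpl; now apply A.
Qed.

(** * Separated eigenfunctions *)

Lemma continuous_prod_sep (F G : R -> R) (P : R * R) :
  continuous F (fst P) -> continuous G (snd P) ->
  continuous (fun Q : R * R => F (fst Q) * G (snd Q)) P.
Proof.
intros HF HG. apply continuous_Rmult.
- apply (continuous_comp fst F); [|exact HF].
  apply (continuous_fst_comp (fun Q => Q)), continuous_id.
- apply (continuous_comp snd G); [|exact HG].
  apply (continuous_snd_comp (fun Q => Q)), continuous_id.
Qed.

(** Separation of variables. The sign of [k] is left open so that both orientations of a rectangle
    are covered; [x0] and [y0] witness that the product is not zero. *)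
Lemma separated_eigenfunction (p q sigma k x0 y0 : R) (F F' G G' : R -> R) :
  (forall x, is_derive F x (F' x)) -> (forall x, is_derive F' x (k * F x)) ->
  (forall y, is_derive G y (G' y)) -> (forall y, is_derive G' y (- k * G y)) ->
  F' p = sigma * F p -> F' (- p) = - (sigma * F (- p)) ->
  G' q = sigma * G q -> G' (- q) = - (sigma * G (- q)) ->
  - p <= x0 <= p -> - q <= y0 <= q -> F x0 <> 0 -> G y0 <> 0 ->
  steklov_eigenfunction p q sigma (fun P => F (fst P) * G (snd P)).
Proof.
intros DF DF' DG DG' Fp Fp' Gq Gq' Hx0 Hy0 Fx0 Gy0.
set (s := fun P : R * R => F (fst P) * G (snd P)).
assert (Dx : forall (H K : R -> R) (H' : R -> R), (forall x, is_derive H x (H' x)) ->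
  forall x y, is_derive (fun t => H t * K y) x (H' x * K y)).
{ intros H K H' HD x y. apply is_derive_ext with (fun t => K y * H t).
  - intros t. apply Rmult_comm.
  - rewrite Rmult_comm. now apply is_derive_scal. }
assert (Dy : forall (H K K' : R -> R), (forall x, is_derive K x (K' x)) ->
  forall x y, is_derive (fun t => H x * K t) y (H x * K' y)).
{ intros H K K' KD x y. now apply is_derive_scal. }
assert (cF : forall x, continuous F x) by (intros x; apply (ex_derive_continuous F); eexists; apply DF).
assert (cF' : forall x, continuous F' x) by (intros x; apply (ex_derive_continuous F'); eexists; apply DF').
assert (cG : forall x, continuous G x) by (intros x; apply (ex_derive_continuous G); eexists; apply DG).
assert (cG' : forall x, continuous G' x) by (intros x; apply (ex_derive_continuous G'); eexists; apply DG').
assert (cFk : forall x, continuous (fun t => k * F t) x)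
  by (intros x; apply continuous_Rmult; [apply continuous_const|apply cF]).
assert (cGk : forall x, continuous (fun t => - k * G t) x)
  by (intros x; apply continuous_Rmult; [apply continuous_const|apply cG]).
assert (PX : forall H K H' : R -> R, (forall x, is_derive H x (H' x)) ->
  partial_x (fun P => H (fst P) * K (snd P)) = (fun P => H' (fst P) * K (snd P))).
{ intros H K H' HD. apply functional_extensionality. intros [x y].
  apply is_derive_unique. now apply (Dx H K H'). }
assert (PY : forall H K K' : R -> R, (forall x, is_derive K x (K' x)) ->
  partial_y (fun P => H (fst P) * K (snd P)) = (fun P => H (fst P) * K' (snd P))).
{ intros H K K' KD. apply functional_extensionality. intros [x y].
  apply is_derive_unique. now apply (Dy H K K'). }
assert (C1 : forall (H H' K K' : R -> R) U,
  (forall x, is_derive H x (H' x)) -> (forall x, is_derive K x (K' x)) ->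
  (forall x, continuous H' x) -> (forall x, continuous K' x) ->
  C1_on U (fun P => H (fst P) * K (snd P))).
{ intros H H' K K' U HD KD cH' cK' P _.
  rewrite (PX H K H' HD), (PY H K K' KD).
  assert (cH : forall x, continuous H x)
    by (intros x; apply (ex_derive_continuous H); eexists; apply HD).
  assert (cK : forall x, continuous K x)
    by (intros x; apply (ex_derive_continuous K); eexists; apply KD).
  split; [|split; [|split]].
  - exists (H' (fst P) * K (snd P)). apply (Dx H K H' HD).
  - exists (H (fst P) * K' (snd P)). apply (Dy H K K' KD).
  - now apply continuous_prod_sep.
  - now apply continuous_prod_sep. }
split.
- exists (x0, y0). split; [now split|]. unfold s; simpl. now apply Rmult_integral_contrapositive.
- apply continuous_on_forall. intros P _. now apply continuous_prod_sep.
- split; [|split].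
  + now apply (C1 F F' G G').
  + unfold s. rewrite (PX F G F' DF). now apply (C1 F' (fun t => k * F t) G G').
  + unfold s. rewrite (PY F G G' DG). now apply (C1 F F' G' (fun t => - k * G t)).
- intros P n _. unfold s. rewrite (PX F G F' DF), (PY F G G' DG).
  split; eexists; (eapply filterlim_filter_le_1; [apply filter_le_within|]);
  now apply continuous_prod_sep.
- intros P _. unfold laplacian, s.
  rewrite (PX F G F' DF), (PX F' G (fun t => k * F t) DF').
  rewrite (PY F G G' DG), (PY F G' (fun t => - k * G t) DG'). ring.
- intros P n Hn.
  replace (sigma * s P) with (F' (fst P) * G (snd P) * fst n + F (fst P) * G' (snd P) * snd n).
  + apply is_normal_derivative_partials with p q; [| |exact Hn].
    * now apply (Dx F G F').
    * now apply (Dy F G G').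
  + unfold s. destruct Hn; simpl; rewrite ?Fp, ?Fp', ?Gq, ?Gq'; ring.
Qed.

Lemma sinh_cosh_le (x y : R) : x <= y -> sinh x * cosh y <= sinh y * cosh x.
Proof.
intros H. unfold sinh, cosh. rewrite !exp_Ropp.
assert (X0 := exp_pos x). assert (Y0 := exp_pos y).
assert (XY : exp x <= exp y) by (destruct H as [H| ->]; [apply Rlt_le, exp_increasing; exact H|lra]).
set (X := exp x) in *. set (Y := exp y) in *.
assert (I : / Y <= / X) by (now apply Rinv_le_contravar).
assert (0 < / Y) by (now apply Rinv_0_lt_compat).
assert (X * / Y <= Y * / X) by (apply Rmult_le_compat; lra). lra.
Qed.

Lemma x_cos_le_sin (x : R) : 0 <= x < PI / 2 -> x * cos x <= sin x.
Proof.
intros [[H0| <-] H1].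
2:{ rewrite sin_0. lra. }
destruct (MVT_cor2 (fun t => sin t - t * cos t) (fun t => t * sin t) 0 x H0) as [c [E Hc]].
- intros c _. apply is_derive_Reals. auto_derive; [easy|ring].
- rewrite sin_0 in E. assert (0 < sin c) by (apply sin_gt_0; lra).
  assert (0 < c * sin c) by (apply Rmult_lt_0_compat; lra). nra.
Qed.

(** A form of [u cot u <= a cot a] without division. The difference of the sides is [(u - a) * cos u
    * sin a - a * sin (u - a)], nonpositive by [sin a <= a], [cos u <= cos (u - a)] and
    [x_cos_le_sin] at [u - a]. *)
Lemma x_cot_x_decreasing (a u : R) :
  0 < a -> a <= u -> u < PI / 2 -> u * cos u * sin a <= a * cos a * sin u.
Proof.
intros a0 au uP.
assert (sa : sin a <= a) by (apply Rlt_le, sin_lt_x; lra).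
assert (sa0 : 0 < sin a) by (apply sin_gt_0; lra).
assert (cu0 : 0 < cos u) by (apply cos_gt_0; lra).
assert (D := x_cos_le_sin (u - a) ltac:(lra)).
assert (cu : cos u <= cos (u - a)) by (apply cos_decr_1; lra).
assert (S := sin_minus u a).
assert (E : u * cos u * sin a - a * cos a * sin u
            = (u - a) * cos u * sin a - a * sin (u - a)) by (rewrite S; ring).
assert ((u - a) * cos u * sin a <= (u - a) * cos (u - a) * a).
{ apply Rmult_le_compat; try lra.
  - apply Rmult_le_pos; lra.
  - apply Rmult_le_compat_l; lra. }
assert (a * ((u - a) * cos (u - a)) <= a * sin (u - a)) by (apply Rmult_le_compat_l; lra).
lra.
Qed.

(** The equation is [tan u * tanh (rho * u) = 1]. At [a] the left side is at most
    [tan a * tanh a = 1], since [rho <= 1], and at [PI / 2] the cosine vanishes; so there is a root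
    not below [a]. *)
Lemma rectangle_root (a rho : R) :
  critical a -> 0 < rho <= 1 ->
  exists u, a <= u < PI / 2 /\ cos u * cosh (rho * u) = sin u * sinh (rho * u).
Proof.
intros Ca Hr. destruct (critical_sin_cos a Ca) as [s0 [c0 _]].
destruct Ca as [Ha E]. assert (P2 := PI2_3_2).
set (f := fun x => sin x * sinh (rho * x) - cos x * cosh (rho * x)).
assert (C : continuity f).
{ intros x. apply derivable_continuous_pt. exists (Derive f x). apply is_derive_Reals.
  apply Derive_correct. unfold f, sinh, cosh. now auto_derive. }
assert (fa : f a <= 0).
{ assert (H := sinh_cosh_le (rho * a) a ltac:(nra)). assert (K := cosh_ge1 a).
  apply Rmult_le_reg_r with (cosh a); [lra|]. unfold f.
  replace ((sin a * sinh (rho * a) - cos a * cosh (rho * a)) * cosh a)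
    with (sin a * (sinh (rho * a) * cosh a) - cos a * cosh a * cosh (rho * a)) by ring.
  rewrite E. nra. }
assert (fP : 0 < f (PI / 2)).
{ unfold f. rewrite sin_PI2, cos_PI2.
  assert (0 < sinh (rho * (PI / 2))) by (apply sinh_pos; nra). lra. }
destruct (IVT_cor f a (PI / 2) C) as [u [Hu fu]]; [lra|nra|].
exists u. assert (u <> PI / 2) by (intros ->; lra).
unfold f in fu. split; lra.
Qed.

(** The sine runs along the longer side. The frequency [w = u / p] satisfies the conditions on both
    pairs of sides with [sigma = w cot u = w tanh (w * q)], so [sigma * p = u cot u], at most
    [a cot a = a tanh a]. *)
Lemma rectangle_eigenvalue (a p q : R) :
  critical a -> 0 < q <= p ->
  exists sigma, 0 < sigma /\ sigma * p <= a * sinh a / cosh a /\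
    steklov_eigenvalue p q sigma /\ steklov_eigenvalue q p sigma.
Proof.
intros Ca Hq. assert (p0 : 0 < p) by lra.
destruct (rectangle_root a (q / p) Ca) as [u [Hu Eu]].
{ split; [apply Rdiv_lt_0_compat; lra|].
  apply Rmult_le_reg_r with p; [exact p0|]. unfold Rdiv.
  rewrite Rmult_assoc, Rinv_l; lra. }
destruct (critical_sin_cos a Ca) as [s0 [c0 _]]. destruct Ca as [Ha E].
assert (su : 0 < sin u) by (apply sin_gt_0; lra).
assert (cu : 0 < cos u) by (apply cos_gt_0; lra).
assert (Ch := cosh_ge1 (q / p * u)). assert (Ca := cosh_ge1 a).
set (w := u / p). assert (w0 : 0 < w) by (apply Rdiv_lt_0_compat; lra).
assert (wp : w * p = u) by (unfold w; field; lra).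
assert (wq : w * q = q / p * u) by (unfold w; field; lra).
set (sigma := w * (cos u / sin u)).
assert (Es : sigma * cosh (q / p * u) = w * sinh (q / p * u)).
{ unfold sigma. apply Rmult_eq_reg_r with (sin u); [|lra].
  replace (w * (cos u / sin u) * cosh (q / p * u) * sin u)
    with (w * (cos u * cosh (q / p * u))) by (field; lra).
  rewrite Eu. ring. }
assert (Fs : sigma * sin u = w * cos u) by (unfold sigma; field; lra).
assert (D1 : forall x, is_derive (fun x => sin (w * x)) x (w * cos (w * x)))
  by (intros x; auto_derive; [easy|ring]).
assert (D2 : forall x, is_derive (fun x => w * cos (w * x)) x (- (w * w) * sin (w * x)))
  by (intros x; auto_derive; [easy|ring]).
assert (D3 : forall x, is_derive (fun x => cosh (w * x)) x (w * sinh (w * x)))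
  by (intros x; unfold cosh, sinh; auto_derive; [easy|field]).
assert (D4 : forall x, is_derive (fun x => w * sinh (w * x)) x (w * w * cosh (w * x)))
  by (intros x; unfold cosh, sinh; auto_derive; [easy|field]).
assert (B1 : w * cos (w * p) = sigma * sin (w * p)) by (rewrite wp; lra).
assert (B2 : w * cos (w * - p) = - (sigma * sin (w * - p))).
{ rewrite <- Ropp_mult_distr_r, cos_neg, sin_neg, wp. lra. }
assert (B3 : w * sinh (w * q) = sigma * cosh (w * q)) by (rewrite wq; lra).
assert (B4 : w * sinh (w * - q) = - (sigma * cosh (w * - q))).
{ rewrite <- Ropp_mult_distr_r, sinh_opp, cosh_opp, wq. lra. }
assert (Np : sin (w * p) <> 0) by (rewrite wp; lra).
assert (Nq : cosh (w * 0) <> 0) by (assert (H := cosh_ge1 (w * 0)); lra).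
exists sigma. split; [|split; [|split]].
- unfold sigma. apply Rmult_lt_0_compat; [exact w0|]. apply Rdiv_lt_0_compat; lra.
- assert (M := x_cot_x_decreasing a u ltac:(lra) ltac:(lra) ltac:(lra)).
  replace (a * sinh a / cosh a) with (a * cos a / sin a).
  2:{ apply Rmult_eq_reg_r with (sin a * cosh a); [|nra].
      transitivity (a * (cos a * cosh a)); [field; lra|].
      rewrite E. field. lra. }
  replace (sigma * p) with (u * cos u / sin u) by (unfold sigma; rewrite <- wp; field; lra).
  apply Rmult_le_reg_r with (sin a * sin u); [nra|].
  replace (u * cos u / sin u * (sin a * sin u)) with (u * cos u * sin a) by (field; lra).
  replace (a * cos a / sin a * (sin a * sin u)) with (a * cos a * sin u) by (field; lra).
  exact M.
- exists (fun P => sin (w * fst P) * cosh (w * snd P)).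
  apply (separated_eigenfunction p q sigma (- (w * w)) p 0
    (fun x => sin (w * x)) (fun x => w * cos (w * x))
    (fun x => cosh (w * x)) (fun x => w * sinh (w * x))); try assumption; try lra.
  intros y. replace (- - (w * w) * cosh (w * y)) with (w * w * cosh (w * y)) by ring. apply D4.
- exists (fun P => cosh (w * fst P) * sin (w * snd P)).
  apply (separated_eigenfunction q p sigma (w * w) 0 p
    (fun x => cosh (w * x)) (fun x => w * sinh (w * x))
    (fun x => sin (w * x)) (fun x => w * cos (w * x))); try assumption; lra.
Qed.

Lemma square_eigenvalue_ge (a r sigma : R) :
  critical a -> 0 < r -> sigma <> 0 -> steklov_eigenvalue r r sigma ->
  a * sinh a / cosh a <= r * sigma.
Proof.
intros Ca r0 sn [s Hs].
destruct (steklov_core_of_eigenfunction r sigma s r0 Hs) as [Hc HP].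
assert (H := steklov_core_lower_bound a (r * sigma) _ Ca
  ltac:(apply Rmult_integral_contrapositive; split; lra) Hc HP).
assert (C := cosh_ge1 a).
apply Rmult_le_reg_r with (cosh a); [lra|].
unfold Rdiv. rewrite Rmult_assoc, Rinv_l; lra.
Qed.

Theorem mainTheorem3 :
  (forall a sigma_a sigma_sq : R,
     0 < a <= 1 ->
     is_sigma1 1 a sigma_a ->
     is_sigma1 1 1 sigma_sq ->
     4 * (1 + a) * sigma_a <= 4 * (1 + 1) * sigma_sq) /\
  (forall p q r sigma sigma_sq : R,
     0 < p -> 0 < q -> 0 < r ->
     perimeter p q = perimeter r r ->
     is_sigma1 p q sigma ->
     is_sigma1 r r sigma_sq ->
     sigma <= sigma_sq).
Proof.
destruct critical_exists as [c Hc].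
assert (S0 : 0 < c * sinh c / cosh c).
{ destruct Hc as [Hc _]. assert (C := cosh_ge1 c). assert (S := sinh_pos c ltac:(lra)).
  apply Rdiv_lt_0_compat; [apply Rmult_lt_0_compat|]; lra. }
set (S := c * sinh c / cosh c) in *.
split.
- intros a sigma sq Ha [_ [_ Hmin]] [Hsq [Hn _]].
  assert (L := square_eigenvalue_ge c 1 sq Hc Rlt_0_1 Hn Hsq). fold S in L.
  (* The longer half-side is 1 for every [a], so [S] bounds the eigenvalue uniformly, and
     [1 + a <= 2] finishes. *)
  destruct (rectangle_eigenvalue c 1 a Hc Ha) as [tau [t0 [tS [He _]]]]. fold S in tS.
  assert (sigma <= tau) by (apply Hmin; lra || assumption).
  assert ((1 + a) * sigma <= (1 + a) * S) by (apply Rmult_le_compat_l; lra).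
  assert ((1 + a) * S <= 2 * S) by (apply Rmult_le_compat_r; lra).
  lra.
- intros p q r sigma sq p0 q0 r0 Hper [_ [_ Hmin]] [Hsq [Hn _]].
  unfold perimeter in Hper.
  assert (L := square_eigenvalue_ge c r sq Hc r0 Hn Hsq). fold S in L.
  (* Equal perimeters mean [p + q = 2 * r], so the longer half-side [h] is at least [r], and
     [tau * r <= tau * h <= S <= r * sq]. *)
  assert (K : forall tau h, 0 < tau -> r <= h -> tau * h <= S -> tau <= sq).
  { intros tau h t0 rh Hth. apply Rmult_le_reg_l with r; [exact r0|].
    assert (tau * r <= tau * h) by (apply Rmult_le_compat_l; lra). lra. }
  destruct (Rle_lt_dec q p) as [H|H].
  + destruct (rectangle_eigenvalue c p q Hc (conj q0 H)) as [tau [t0 [tS [He _]]]].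
    apply Rle_trans with tau; [apply Hmin; lra || assumption|].
    apply (K tau p); lra || assumption.
  + destruct (rectangle_eigenvalue c q p Hc (conj p0 (Rlt_le _ _ H)))
      as [tau [t0 [tS [_ He]]]].
    apply Rle_trans with tau; [apply Hmin; lra || assumption|].
    apply (K tau q); lra || assumption.
Qed.
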